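(* Let $n\ge 1$. (1) The two variable Tong-Yang-Ma matrix $\mathcal{TYM}(L)$ is an invariant of the $n$-string link $L$ (i.e. it depends only on the equivalence class of $L$, not on the chosen diagram). (2) For any two $n$-string links $L$ and $L'$, $$\mathcal{TYM}(LL')=\mathcal{TYM}(L)\,\mathcal{TYM}(L').$$ In particular, the map $\mathcal{TYM}\colon \mathcal{SL}_n\to \mathrm{GL}_n(\mathbb{Z}[\Lambda])$, $L\mapsto \mathcal{TYM}(L)$, is a representation (monoid homomorphism) of the $n$-string link monoid $\mathcal{SL}_n$.
   Context: String links. Fix points $z_1<\dots<z_n$ in $(-1,1)\times\{0\}\subset \mathrm{Int}(\mathbb{D}^2)$, $\mathbb{D}^2$ the unit disk. An $n$-string link is an embedding of a disjoint union of $n$ oriented intervals in $\mathbb{D}^2\times[0,1]$ such that each initial point is some $z_i\times\{0\}$ and each endpoint is some $z_j\times\{1\}$; the interval starting at $z_i\times\{0\}$ is the $i$-th string. String links are represented by planar diagrams, drawn with the points $z_i\times\{0\}$ at the top and $z_j\times\{1\}$ at the bottom, ordered from left to right. Two $n$-string links are equivalent if their diagrams are related by planar isotopy and finitely many Reidemeister moves R1, R2, R3. $\mathcal{SL}_n$ is the monoid of equivalence classes under concatenation ($LL'$ is $L$ followed by $L'$). $\Lambda$-groups. $\Lambda$ is the free abelian group (written multiplicatively) on $u,v$. A $\Lambda$-group is a group with a right action of $\Lambda$ by automorphisms, $(g,w)\mapsto g^w$. A $\Lambda$-presentation has, for each $\Lambda$-generator $a$, a family of group generators indexed by $\Lambda\cong\mathbb{Z}^{2}$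 permuted by translation, and each $\Lambda$-relation stands for all its $\Lambda$-translates. Let $D$ be a diagram of $L$ with $N$ crossings. Cut every string at every crossing (both over and under), and label the resulting $n+2N$ edges; the top edges are $a_1,\dots,a_n$ and the bottom edges $x_1,\dots,x_n$ from left to right (if the same edge is top edge $i$ and bottom edge $j$, the relation $x_j=a_i$ is imposed). $K$ is the $\Lambda$-group with these labels as $\Lambda$-generators and the following $\Lambda$-relations at each crossing of sign $\varepsilon=\pm1$: if the under-string enters along edge $e$ and leaves along $e'$, and the over-string enters along $f$ and leaves along $f'$, then $e'=e^{u^{\varepsilon}}$ and $f'=f^{v^{\varepsilon}}$. Eliminating the other generators, $K=\langle a_1,\dots,a_n,x_1,\dots,x_n\mid x_1=a_{i_1}^{w_1},\dots,x_n=a_{i_n}^{w_n}\rangle$ with $w_j\in\Lambda$, where the $i_j$-th string ends at $z_j\times\{1\}$. Define $\widetilde K=\langle a_1,\dots,a_n,x_1,\dots,x_n\mid x_j=a_{i_j}^{w_j(uv)^{-k_j}},\ 1\le j\le n\rangle$, where $k_j$ is the sum of the signs of the self-crossings of the $i_j$-th string. The abelianization $\widetilde K^{\mathrm{ab}}$ is a free $\mathbb{Z}[\Lambda]$-module for which both $\mathcal S=(a_1,\dots,a_n)$ and $\mathcal T=(x_1,\dots,x_n)$ are ordered bases. The two variable Tong-Yang-Ma matrix $\mathcal{TYM}(L)\in \mathrm{GL}_n(\mathbb{Z}[\Lambda])$ is the change of basis matrix with $\mathcal S\,\mathcal{TYM}(L)=\mathcal T$, i.e. its $(i_j,j)$ entry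 is $w_j(uv)^{-k_j}$ and all other entries are $0$. *)

(* Defs.v *)
From HB Require Import structures.
From Stdlib Require Import Relation_Operators.
From mathcomp Require Import all_boot all_order all_algebra.
From mathcomp Require Import finmap generic_quotient.
From mathcomp.multinomials Require Import monalg.
From mathcomp Require Import boolp classical_sets.

Set Implicit Arguments.
Unset Strict Implicit.
Unset Printing Implicit Defensive.

Import GRing.Theory.
Local Open Scope ring_scope.
Local Open Scope quotient_scope.

(* Additive encoding: the pair (p, q) stands for u ^ p v ^ q. *)
Definition Lambda : Type := (int * int)%type.
HB.instance Definition _ := GRing.Zmodule.on Lambda.

Definition upow (e : int) : Lambda := (e, 0).
Definition vpow (e : int) : Lambda := (0, e).

Definition ZLambda : Type := {malg int[Lambda]}.
HB.instance Definition _ := GRing.Zmodule.on ZLambda.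

Definition zl1 : ZLambda := << 1 *g 0 >>.

HB.lock Definition zlmul (f g : ZLambda) : ZLambda :=
  \sum_(a <- msupp f) \sum_(b <- msupp g) << f@_a * g@_b *g a + b >>.

Section GroupRing.
Implicit Types (f g h : ZLambda) (a b : Lambda).

Lemma zlmulw (A B : {fset Lambda}) f g :
    (msupp f `<=` A)%fset -> (msupp g `<=` B)%fset ->
  zlmul f g = \sum_(a <- A) \sum_(b <- B) << f@_a * g@_b *g a + b >>.
Proof.
move=> fA gB; rewrite unlock (big_fset_incl _ fA) /=.
  apply/eq_bigr => a _; apply/big_fset_incl => // b _ /mcoeff_outdom ->.
  by rewrite mulr0 monalgU0.
move=> a _ /mcoeff_outdom fa.
by rewrite big1 // => b _; rewrite fa mul0r monalgU0.
Qed.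

Lemma zlmulUU (c d : int) a b :
  zlmul << c *g a >> << d *g b >> = << c * d *g a + b >>.
Proof. by rewrite (zlmulw msuppU_le msuppU_le) !big_seq_fset1 !mcoeffUU. Qed.

Lemma zlmulC : commutative zlmul.
Proof.
move=> f g; rewrite unlock exchange_big /=.
by apply/eq_bigr => b _; apply/eq_bigr => a _; rewrite mulrC addrC.
Qed.

Lemma zlmulDl : left_distributive zlmul +%R.
Proof.
move=> f g h.
rewrite (zlmulw (fsubsetUl (msupp f) (msupp g)) (fsubset_refl (msupp h))).
rewrite (zlmulw (fsubsetUr (msupp f) (msupp g)) (fsubset_refl (msupp h))).
rewrite (zlmulw (msuppD_le f g) (fsubset_refl (msupp h))).
rewrite -big_split /=; apply/eq_bigr=> a _.
rewrite -big_split /=; apply/eq_bigr=> b _.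
by rewrite mcoeffD mulrDl monalgUD.
Qed.

Lemma zlmul0 : left_zero 0 zlmul.
Proof. by move=> f; rewrite unlock msupp0 big_seq_fset0. Qed.

Lemma zlmul_suml (I : Type) (r : seq I) (F : I -> ZLambda) g :
  zlmul (\sum_(i <- r) F i) g = \sum_(i <- r) zlmul (F i) g.
Proof. exact: (big_morph (zlmul^~ g) (fun _ _ => zlmulDl _ _ _) (zlmul0 g)). Qed.

Lemma zlmul_sumr (I : Type) (r : seq I) (F : I -> ZLambda) g :
  zlmul g (\sum_(i <- r) F i) = \sum_(i <- r) zlmul g (F i).
Proof.
by rewrite zlmulC zlmul_suml; apply/eq_bigr => i _; rewrite zlmulC.
Qed.

Lemma zlmulA : associative zlmul.
Proof.
move=> f g h; rewrite (monalgE f) (monalgE g) (monalgE h).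
rewrite !zlmul_suml; apply: eq_bigr => a _.
rewrite !zlmul_sumr.
under [RHS]eq_bigr do rewrite zlmul_suml.
rewrite [RHS]exchange_big /=; apply: eq_bigr => b _.
rewrite !zlmul_sumr; apply: eq_bigr => c _.
by rewrite !zlmulUU mulrA addrA.
Qed.

Lemma zl1mul : left_id zl1 zlmul.
Proof.
move=> f; rewrite {1}(monalgE f) zlmul_sumr [RHS]monalgE.
by apply/eq_bigr => a _; rewrite zlmulUU mul1r add0r.
Qed.

Lemma zl1_neq0 : zl1 != 0.
Proof. by rewrite monalgU_eq0. Qed.

HB.instance Definition _ := GRing.Zmodule_isComNzRing.Build ZLambda
  zlmulA zlmulC zl1mul zlmulDl zl1_neq0.

Lemma zlmulE f g : f * g = zlmul f g. Proof. by []. Qed.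

Definition zlunit : {pred ZLambda} := fun f => `[< exists g, g * f = 1 >].
Definition zlinv f : ZLambda :=
  if f \in zlunit then xget f [set g | g * f = 1]%classic else f.

Fact zlmulV : {in zlunit, left_inverse 1 zlinv *%R}.
Proof.
move=> f fU; rewrite /zlinv fU; case: xgetP => [g _ //|nof].
by have /asboolP[g gf] := fU; case: (nof g).
Qed.

Fact zlunitP f g : g * f = 1 -> f \in zlunit.
Proof. by move=> gf; apply/asboolP; exists g. Qed.

Fact zlinv_out : {in [predC zlunit], zlinv =1 id}.
Proof. by move=> f; rewrite inE /= /zlinv => /negbTE ->. Qed.

HB.instance Definition _ := GRing.ComNzRing_hasMulInverse.Build ZLambda
  zlmulV zlunitP zlinv_out.

End GroupRing.

HB.mixin Record isLambdaGroup G of Group G := {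
  lact : G -> Lambda -> G;
  lact0 : forall g, lact g 0 = g;
  lactD : forall g w z, lact g (w + z) = lact (lact g w) z;
  lactM : forall g h w, lact (g * h)%g w = (lact g w * lact h w)%g
}.
#[short(type="lambdaGroupType")]
HB.structure Definition LambdaGroup := {G of Group G & isLambdaGroup G}.

Section Presentation.
Context (E : choiceType) (R : E -> Lambda -> E -> Prop).

(* The letter (b, (e, w)) is the group generator e ^ w, inverted if b holds. *)
Definition word : Type := seq (bool * (E * Lambda)).
HB.instance Definition _ := Choice.on word.

Definition wshift (z : Lambda) (s : word) : word :=
  [seq (x.1, (x.2.1, x.2.2 + z)) | x <- s].
Definition winv (s : word) : word := rev [seq (~~ x.1, x.2) | x <- s].

(* R e w e' stands for the Lambda-relation e' = e ^ w. *)
Inductive pcong : word -> word -> Prop :=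
| pcong_refl s : pcong s s
| pcong_sym s t : pcong s t -> pcong t s
| pcong_trans s t r : pcong s t -> pcong t r -> pcong s r
| pcong_cat s s' t t' : pcong s s' -> pcong t t' -> pcong (s ++ t) (s' ++ t')
| pcong_cancel b x : pcong [:: (b, x); (~~ b, x)] [::]
| pcong_rel e w e' z : R e w e' ->
    pcong [:: (false, (e', z))] [:: (false, (e, w + z))].

Definition pcongb s t := `[< pcong s t >].

Fact pcongb_refl : reflexive pcongb.
Proof. by move=> s; apply/asboolP/pcong_refl. Qed.
Fact pcongb_sym : symmetric pcongb.
Proof. by move=> s t; apply/asboolP/asboolP; apply: pcong_sym. Qed.
Fact pcongb_trans : transitive pcongb.
Proof.
by move=> t s r /asboolP st /asboolP tr; apply/asboolP/(pcong_trans st tr).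
Qed.

Canonical pcong_equiv := EquivRel pcongb pcongb_refl pcongb_sym pcongb_trans.

Definition presented : Type := {eq_quot pcong_equiv}.
HB.instance Definition _ := Choice.on presented.
HB.instance Definition _ := EqQuotient.on presented.

Definition pcl (s : word) : presented := \pi_presented s.

Lemma pclP s t : pcl s = pcl t <-> pcong s t.
Proof. by split=> [/eqmodP/asboolP|st]; last apply/eqmodP/asboolP. Qed.

Lemma pcl_repr x : pcl (repr x) = x. Proof. exact: reprK. Qed.

Lemma pcong_winv s t : pcong s t -> pcong (winv s) (winv t).
Proof.
elim=> {s t} [s|s t _|s t r _ + _|s s' t t' _ + _|b x|e w e' z Re].
- exact: pcong_refl.
- exact: pcong_sym.
- exact: pcong_trans.
- by rewrite /winv !map_cat !rev_cat => *; apply: pcong_cat.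
- by rewrite /winv /= negbK; apply: pcong_cancel.
rewrite /winv /=; set x := (e', z); set y := (e, w + z).
have xy : pcong [:: (false, x)] [:: (false, y)] by apply: pcong_rel.
apply: (@pcong_trans _ ([:: (true, x)] ++ [:: (false, y); (true, y)])).
  by rewrite -[X in pcong X _]cats0; apply: pcong_cat; [exact: pcong_refl|];
     apply/pcong_sym/pcong_cancel.
rewrite -[X in pcong _ X]cat0s -[[:: _; _]](cat1s _ [:: _]) catA.
apply: pcong_cat; last exact: pcong_refl.
apply: pcong_trans (pcong_cancel true x).
rewrite -[[:: (true, x); _]]cat1s.
by apply: pcong_cat; [exact: pcong_refl|apply: pcong_sym].
Qed.

Lemma pcong_shift v s t : pcong s t -> pcong (wshift v s) (wshift v t).
Proof.
elim=> {s t} [s|s t _|s t r _ + _|s s' t t' _ + _|b x|e w e' z Re] /=.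
- exact: pcong_refl.
- exact: pcong_sym.
- exact: pcong_trans.
- by rewrite /wshift !map_cat => *; apply: pcong_cat.
- exact: pcong_cancel.
by rewrite -addrA; apply: pcong_rel.
Qed.

Lemma pcong_catV s : pcong (winv s ++ s) [::].
Proof.
elim: s => [|x s IH]; first exact: pcong_refl.
rewrite /winv /= rev_cons -cats1 -catA /=.
apply: pcong_trans IH; apply: pcong_cat; first exact: pcong_refl.
rewrite -[X in pcong _ X]cat0s -(cat1s x) -cat_cons.
apply: pcong_cat; last exact: pcong_refl.
by case: x => b x /=; rewrite -{2}[b]negbK; apply: pcong_cancel.
Qed.

Definition pmul (x y : presented) := pcl (repr x ++ repr y).
Definition pinv (x : presented) := pcl (winv (repr x)).
Definition pact (x : presented) (z : Lambda) := pcl (wshift z (repr x)).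

Lemma pmulE s t : pmul (pcl s) (pcl t) = pcl (s ++ t).
Proof. by apply/pclP/pcong_cat; apply/pclP; rewrite pcl_repr. Qed.
Lemma pinvE s : pinv (pcl s) = pcl (winv s).
Proof. by apply/pclP/pcong_winv; apply/pclP; rewrite pcl_repr. Qed.
Lemma pactE s z : pact (pcl s) z = pcl (wshift z s).
Proof. by apply/pclP/pcong_shift; apply/pclP; rewrite pcl_repr. Qed.

Fact pmulA : associative pmul.
Proof.
move=> x y z; rewrite -(pcl_repr x) -(pcl_repr y) -(pcl_repr z).
by rewrite !pmulE catA.
Qed.
Fact pmul1 : left_id (pcl [::]) pmul.
Proof. by move=> x; rewrite -(pcl_repr x) pmulE. Qed.
Fact pmulx1 : right_id (pcl [::]) pmul.
Proof. by move=> x; rewrite -(pcl_repr x) pmulE cats0. Qed.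
Fact pmulVx : left_inverse (pcl [::]) pinv pmul.
Proof.
by move=> x; rewrite -(pcl_repr x) pinvE pmulE; apply/pclP/pcong_catV.
Qed.
Fact pmulxV : right_inverse (pcl [::]) pinv pmul.
Proof.
move=> x; rewrite -(pcl_repr x) pinvE pmulE; apply/pclP.
rewrite -{1}[repr x](_ : winv (winv (repr x)) = _); first exact: pcong_catV.
rewrite /winv map_rev revK -map_comp map_id_in // => -[b y] _ /=.
by rewrite negbK.
Qed.

HB.instance Definition _ := isGroup.Build presented
  pmulA pmul1 pmulx1 pmulVx pmulxV.

Fact pact0 (x : presented) : pact x 0 = x.
Proof.
rewrite -(pcl_repr x) pactE /wshift map_id_in // => -[b [e w]] _ /=.
by rewrite addr0.
Qed.
Fact pactD (x : presented) w z : pact x (w + z) = pact (pact x w) z.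
Proof.
rewrite -(pcl_repr x) !pactE /wshift -map_comp; congr pcl.
by apply/eq_map => -[b [e y]] /=; rewrite addrA.
Qed.
Fact pactM (x y : presented) w : pact (x * y)%g w = (pact x w * pact y w)%g.
Proof.
rewrite -[(_ * _)%g]/(pmul _ _) -[RHS]/(pmul _ _) -(pcl_repr x) -(pcl_repr y).
by rewrite !(pmulE, pactE) /wshift map_cat.
Qed.

HB.instance Definition _ := isLambdaGroup.Build presented pact0 pactD pactM.

Definition pgen (e : E) : presented := pcl [:: (false, (e, 0))].

End Presentation.

Section Abelianization.
Context (G : lambdaGroupType).

Inductive abcong : G -> G -> Prop :=
| abcong_refl x : abcong x x
| abcong_sym x y : abcong x y -> abcong y x
| abcong_trans x y z : abcong x y -> abcong y z -> abcong x z
| abcong_mul x x' y y' : abcong x x' -> abcong y y' ->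
    abcong (x * y)%g (x' * y')%g
| abcong_comm x y : abcong (x * y)%g (y * x)%g.

Definition abcongb x y := `[< abcong x y >].

Fact abcongb_refl : reflexive abcongb.
Proof. by move=> s; apply/asboolP/abcong_refl. Qed.
Fact abcongb_sym : symmetric abcongb.
Proof. by move=> s t; apply/asboolP/asboolP; apply: abcong_sym. Qed.
Fact abcongb_trans : transitive abcongb.
Proof.
by move=> t s r /asboolP st /asboolP tr; apply/asboolP/(abcong_trans st tr).
Qed.

Canonical abcong_equiv :=
  EquivRel abcongb abcongb_refl abcongb_sym abcongb_trans.

Definition ab : Type := {eq_quot abcong_equiv}.
HB.instance Definition _ := Choice.on ab.
HB.instance Definition _ := EqQuotient.on ab.

Definition abcl (x : G) : ab := \pi_ab x.

Lemma abclP x y : abcl x = abcl y <-> abcong x y.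
Proof. by split=> [/eqmodP/asboolP|xy]; last apply/eqmodP/asboolP. Qed.

Lemma abcl_repr x : abcl (repr x) = x. Proof. exact: reprK. Qed.

Lemma abcong_inv x y : abcong x y -> abcong x^-1%g y^-1%g.
Proof.
move=> xy; have -> : (x^-1 = x^-1 * (y * y^-1))%g by rewrite mulgV mulg1.
have {2}-> : (y^-1 = x^-1 * (x * y^-1))%g by rewrite mulKg.
apply: abcong_mul; first exact: abcong_refl.
by apply: abcong_mul; [exact: abcong_sym|exact: abcong_refl].
Qed.

Lemma abcong_act x y w : abcong x y -> abcong (lact x w) (lact y w).
Proof.
elim=> {x y} [x|x y _|x y z _ + _|x x' y y' _ + _|x y].
- exact: abcong_refl.
- exact: abcong_sym.
- exact: abcong_trans.
- by rewrite !lactM => *; apply: abcong_mul.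
by rewrite !lactM; apply: abcong_comm.
Qed.

Definition abadd (x y : ab) := abcl (repr x * repr y)%g.
Definition abopp (x : ab) := abcl (repr x)^-1%g.
Definition abact (w : Lambda) (x : ab) := abcl (lact (repr x) w).

Lemma abaddE x y : abadd (abcl x) (abcl y) = abcl (x * y)%g.
Proof. by apply/abclP/abcong_mul; apply/abclP; rewrite abcl_repr. Qed.
Lemma aboppE x : abopp (abcl x) = abcl x^-1%g.
Proof. by apply/abclP/abcong_inv; apply/abclP; rewrite abcl_repr. Qed.
Lemma abactE x w : abact w (abcl x) = abcl (lact x w).
Proof. by apply/abclP/abcong_act; apply/abclP; rewrite abcl_repr. Qed.

Fact abaddA : associative abadd.
Proof.
move=> x y z; rewrite -(abcl_repr x) -(abcl_repr y) -(abcl_repr z).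
by rewrite !abaddE mulgA.
Qed.
Fact abaddC : commutative abadd.
Proof.
move=> x y; rewrite -(abcl_repr x) -(abcl_repr y) !abaddE.
exact/abclP/abcong_comm.
Qed.
Fact abadd0 : left_id (abcl 1%g) abadd.
Proof. by move=> x; rewrite -(abcl_repr x) abaddE mul1g. Qed.
Fact abaddN : left_inverse (abcl 1%g) abopp abadd.
Proof. by move=> x; rewrite -(abcl_repr x) aboppE abaddE mulVg. Qed.

HB.instance Definition _ := GRing.isZmodule.Build ab
  abaddA abaddC abadd0 abaddN.

Lemma abclM x y : abcl (x * y)%g = abcl x + abcl y.
Proof. by rewrite -abaddE. Qed.

Lemma abactB w : {morph abact w : x y / x - y}.
Proof.
have D : {morph abact w : x y / x + y}.
  move=> x y; rewrite -(abcl_repr x) -(abcl_repr y) -abclM !abactE.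
  by rewrite lactM abclM.
by move=> x y; apply: (addIr (abact w y)); rewrite -D !subrK.
Qed.
HB.instance Definition _ w := GRing.isZmodMorphism.Build ab ab (abact w)
  (@abactB w).

Lemma abact_mulrz x w (k : int) : abact w (x *~ k) = abact w x *~ k.
Proof. exact: (raddfMz (abact w)). Qed.
Lemma abact_sum (I : Type) (r : seq I) (F : I -> ab) w :
  abact w (\sum_(i <- r) F i) = \sum_(i <- r) abact w (F i).
Proof. exact: (raddf_sum (abact w)). Qed.
Lemma abact0 x : abact 0 x = x.
Proof. by rewrite -(abcl_repr x) abactE lact0. Qed.
Lemma abactD x w z : abact (w + z) x = abact z (abact w x).
Proof. by rewrite -(abcl_repr x) !abactE lactD. Qed.

Definition abscale (f : ZLambda) (x : ab) : ab :=
  \sum_(w <- msupp f) abact w x *~ f@_w.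

Lemma abscalew (A : {fset Lambda}) (f : ZLambda) x : (msupp f `<=` A)%fset ->
  abscale f x = \sum_(w <- A) abact w x *~ f@_w.
Proof.
move=> fA; apply/big_fset_incl => // w _ /mcoeff_outdom ->.
by rewrite mulr0z.
Qed.

Lemma abscaleU (c : int) w x : abscale << c *g w >> x = abact w x *~ c.
Proof. by rewrite (abscalew _ msuppU_le) big_seq_fset1 mcoeffUU. Qed.

Fact abscaleDr : right_distributive abscale +%R.
Proof.
move=> f x y; rewrite -big_split; apply/eq_bigr => w _ /=.
by rewrite (raddfD (abact w)) mulrzDl.
Qed.

Fact abscaleDl x : {morph abscale^~ x : f g / f + g}.
Proof.
move=> f g.
rewrite (abscalew _ (fsubsetUl (msupp f) (msupp g))).
rewrite (abscalew _ (fsubsetUr (msupp f) (msupp g))).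
rewrite (abscalew _ (msuppD_le f g)) -big_split; apply/eq_bigr => w _ /=.
by rewrite mcoeffD mulrzDr.
Qed.

Lemma abscale0 x : abscale 0 x = 0.
Proof. by rewrite /abscale msupp0 big_seq_fset0. Qed.

Lemma abscale_suml (I : Type) (r : seq I) (F : I -> ZLambda) x :
  abscale (\sum_(i <- r) F i) x = \sum_(i <- r) abscale (F i) x.
Proof.
exact: (big_morph (abscale^~ x) (fun _ _ => abscaleDl _ _ _) (abscale0 x)).
Qed.

Fact abscaleA (f g : ZLambda) x : abscale f (abscale g x) = abscale (f * g) x.
Proof.
rewrite zlmulE unlock abscale_suml; apply/eq_bigr => a _.
rewrite abscale_suml abact_sum mulrz_suml; apply/eq_bigr => b _.
by rewrite abscaleU abact_mulrz -mulrzA [g@_b * _]mulrC addrC abactD.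
Qed.

Fact abscale1 : left_id 1 abscale.
Proof. by move=> x; rewrite abscaleU abact0. Qed.

HB.instance Definition _ := GRing.Zmodule_isLmodule.Build ZLambda ab
  abscaleA abscale1 abscaleDr abscaleDl.

End Abelianization.

(* A diagram is drawn from top to bottom as a stack of layers, one elementary
   piece per layer.  A horizontal level is recorded by the orientations of the
   strands it meets, from left to right (true = downwards). *)
Inductive piece :=
  (* The strand running from top left to bottom right has orientation a, the
     one running from top right to bottom left has orientation b, and the
     latter is the over-strand iff ov holds. *)
| Cross (ov a b : bool)
  (* Local minimum and local maximum; a is the orientation of the left arm. *)
| Cup (a : bool)
| Cap (a : bool).

Definition piece_code (g : piece) : bool * bool * bool + (bool + bool) :=
  match g with
  | Cross ov a b => inl (ov, a, b)
  | Cup a => inr (inl a)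
  | Cap a => inr (inr a)
  end.
Definition piece_decode c : piece :=
  match c with
  | inl (ov, a, b) => Cross ov a b
  | inr (inl a) => Cup a
  | inr (inr a) => Cap a
  end.
Fact piece_codeK : cancel piece_code piece_decode.
Proof. by case. Qed.
HB.instance Definition _ := Choice.copy piece (can_type piece_codeK).

Definition pdom (g : piece) : seq bool :=
  match g with
  | Cross _ a b => [:: a; b]
  | Cup a => [:: a; ~~ a]
  | Cap _ => [::]
  end.
Definition pcod (g : piece) : seq bool :=
  match g with
  | Cross _ a b => [:: b; a]
  | Cup _ => [::]
  | Cap a => [:: a; ~~ a]
  end.

(* lleft and lright are the vertical strands beside the piece. *)
Record layer := Layer { lleft : seq bool; lpiece : piece; lright : seq bool }.
Definition layer_code (l : layer) := (lleft l, lpiece l, lright l).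
Definition layer_decode c := let: (s, g, t) := c in Layer s g t.
Fact layer_codeK : cancel layer_code layer_decode.
Proof. by case. Qed.
HB.instance Definition _ := Choice.copy layer (can_type layer_codeK).

Definition ltop (l : layer) := lleft l ++ pdom (lpiece l) ++ lright l.
Definition lbot (l : layer) := lleft l ++ pcod (lpiece l) ++ lright l.

Fixpoint stack (s : seq bool) (D : seq layer) (t : seq bool) : bool :=
  if D is l :: D' then (ltop l == s) && stack (lbot l) D' t else s == t.

Definition layer0 := Layer [::] (Cup true) [::].

(* All strings run from top to bottom: both ends are oriented downwards. *)
Definition ends (n : nat) : seq bool := nseq n true.

Section Tracing.
Context (n : nat) (D : seq layer).

Definition level (k : nat) : seq bool := nth [::] (ends n :: map lbot D) k.

(* The point (k, p) is the p-th point from the left at level k, the levels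
   0 .. size D being the horizontal lines that separate the layers. *)
Definition is_point (x : nat * nat) : bool :=
  (x.1 <= size D)%N && (x.2 < size (level x.1))%N.

Definition downward (x : nat * nat) : bool := nth true (level x.1) x.2.

(* Enter layer l at position p, from its top or from its bottom: the side and
   the position at which the strand leaves the layer. *)
Definition through (l : layer) (top : bool) (p : nat) : bool * nat :=
  let m := size (lleft l) in
  let din := size (if top then pdom (lpiece l) else pcod (lpiece l)) in
  let dout := size (if top then pcod (lpiece l) else pdom (lpiece l)) in
  if (p < m)%N then (~~ top, p)
  else if (p < m + din)%N then
    (if lpiece l is Cross _ _ _ then ~~ top else top, m + (1 - (p - m)))%N
  else (~~ top, p + dout - din)%N.

(* The index of the layer entered at x when following the orientation. *)
Definition entered (x : nat * nat) : option nat :=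
  if downward x then (if (x.1 < size D)%N then Some x.1 else None)
  else (if (0 < x.1)%N then Some x.1.-1 else None).

(* The next point on the string of x, following its orientation. *)
Definition next_point (x : nat * nat) : option (nat * nat) :=
  if entered x is Some k then
    let: (top, p) := through (nth layer0 D k) (downward x) x.2 in
    Some ((if top then k else k.+1), p)
  else None.

(* x lies on the i-th string, i.e. on the one that starts at (0, i). *)
Definition on_string (i : nat) (x : nat * nat) : Prop :=
  exists m : nat, iter m (obind next_point) (Some (0, i)) = Some x.

(* The second condition excludes closed components.  A strand that starts at
   the top can only end at the bottom, because of the orientations there. *)
Definition string_link : bool :=
  stack (ends n) D (ends n) &&
  `[< forall x, is_point x -> exists2 i, (i < n)%N & on_string i x >].

(* +1 iff the over-strand has to be turned counterclockwise (by less than a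
   half-turn) to take the direction of the under-strand; 0 for a non-crossing. *)
Definition crossing_sign (k : nat) : int :=
  if lpiece (nth layer0 D k) is Cross ov a b then
    (if ov == (a == b) then 1 else -1)
  else 0.

(* Some true (Some false) if, from x to next_point x, the string goes over (under)
   at a crossing; None if it meets no crossing there. *)
Definition passage (x : nat * nat) : option bool :=
  if entered x is Some k then
    let l := nth layer0 D k in let m := size (lleft l) in
    if lpiece l is Cross ov _ _ then
      if (m <= x.2 < m + 2)%N
      then Some (((x.2 == m.+1) == downward x) == ov) else None
    else None
  else None.

(* The exponent w such that the label of next_point x is the label of x acted on by
   w; it is trivial iff x and next_point x lie on the same edge. *)
Definition exponent (x : nat * nat) : Lambda :=
  match entered x, passage x with
  | Some k, Some true => vpow (crossing_sign k)
  | Some k, Some false => upow (crossing_sign k)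
  | _, _ => 0
  end.

Definition self_crossing (i k : nat) : Prop :=
  let m := size (lleft (nth layer0 D k)) in
  [/\ crossing_sign k != 0, on_string i (k, m) & on_string i (k, m.+1)].

Definition self_writhe (i : nat) : int :=
  \sum_(k < size D | `[< self_crossing i k >]) crossing_sign k.

End Tracing.

Record diagram (n : nat) := Diagram {
  layers :> seq layer;
  layersP : string_link n layers
}.
HB.instance Definition _ n := [isSub for @layers n].
HB.instance Definition _ n := [Choice of diagram n by <:].

Lemma level_last n D t : stack (ends n) D t -> level n D (size D) = t.
Proof.
rewrite /level; elim: D (ends n) => [|l D IH] s /=; first by move/eqP.
by case/andP => _ /IH.
Qed.

Lemma stack_cat s D D' t t' :
  stack s D t -> stack t D' t' -> stack s (D ++ D') t'.
Proof.
elim: D s => [|l D IH] s /=; first by move/eqP->.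
by case/andP => -> /IH H /H.
Qed.

Section Concatenation.
Context (n : nat) (D D' : seq layer) (st : stack (ends n) D (ends n)).

Lemma level_catl k : (k <= size D)%N -> level n (D ++ D') k = level n D k.
Proof.
by move=> kD; rewrite /level map_cat -cat_cons nth_cat /= size_map ltnS kD.
Qed.

Lemma level_catr k : level n (D ++ D') (k + size D) = level n D' k.
Proof.
case: k => [|k]; first by rewrite add0n level_catl // (level_last st).
rewrite /level map_cat -cat_cons nth_cat /= size_map ltnS leqNgt addSn.
by rewrite ltnS leq_addl /= subSS addnK.
Qed.

Lemma next_level x y : (x.1 <= size D)%N -> next_point n D x = Some y ->
  (y.1 <= size D)%N.
Proof.
case: x => k p /= kD; rewrite /next_point /entered /=.
case: downward; last first.
  by case: k kD => //= k kD; case: through => -[] q [<-] //=; apply: ltnW.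
by case: ltnP => // kD'; case: through => -[] q [<-].
Qed.

Lemma next_catl x y : (x.1 <= size D)%N ->
  next_point n D x = Some y -> next_point n (D ++ D') x = Some y.
Proof.
case: x => k p /= kD; rewrite /next_point /entered /downward /= level_catl //.
case: (nth _ _ _); last by case: k kD => //= k kD; rewrite nth_cat kD.
by case: ltnP => // kD'; rewrite size_cat ltn_addr // nth_cat kD'.
Qed.

Definition below (x : nat * nat) : nat * nat := ((x.1 + size D)%N, x.2).

Lemma next_catr x y :
  next_point n D' x = Some y -> next_point n (D ++ D') (below x) = Some (below y).
Proof.
have nthr k : nth layer0 (D ++ D') (k + size D) = nth layer0 D' k.
  by rewrite nth_cat ltnNge leq_addl /= addnK.
case: x => k p; rewrite /next_point /entered /downward /= level_catr.
case: (nth _ _ _); last first.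
  by case: k => //= k; rewrite nthr; case: through => -[] q [<-].
case: ltnP => // kD'; rewrite size_cat addnC ltn_add2l kD' addnC nthr.
by case: through => -[] q [<-].
Qed.

Lemma on_string_catl i x : on_string n D i x -> on_string n (D ++ D') i x.
Proof.
case=> m; suff H : iter m (obind (next_point n D)) (Some (0, i)) = Some x ->
    iter m (obind (next_point n (D ++ D'))) (Some (0, i)) = Some x /\
    (x.1 <= size D)%N by move/H => [? _]; exists m.
elim: m x => [|m IH] x /=; first by case=> <-.
case E: (iter m _ _) => [y|] //= yx; have [-> yD] := IH y E.
by split; [apply: next_catl|apply: next_level yx].
Qed.

Lemma on_string_catr i j x : on_string n D i (size D, j) ->
  on_string n D' j x -> on_string n (D ++ D') i (below x).
Proof.
move=> /on_string_catl[m Em] [m']; elim: m' x => [|m' IH] x /=.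
  by case=> <-; exists m; rewrite Em.
case E: (iter m' _ _) => [y|] //= yx; have [m2 E2] := IH y E.
by exists m2.+1; rewrite /= E2 /=; apply: next_catr.
Qed.

Lemma string_link_cat : string_link n D -> string_link n D' ->
  string_link n (D ++ D').
Proof.
case/andP => _ /asboolP oD /andP[st' /asboolP oD'].
apply/andP; split; first exact: stack_cat st st'.
apply/asboolP => -[k p] /andP[/= kDD pk]; case: (leqP k (size D)) => kD.
  have [|i ltin] := oD (k, p); last by exists i => //; apply: on_string_catl.
  by rewrite /is_point /= kD -level_catl.
move: kDD pk; rewrite -(subnK (ltnW kD)) size_cat addnC leq_add2l addnC.
rewrite level_catr => kD' pk; have [|j ltjn jk] := oD' ((k - size D)%N, p).
  by rewrite /is_point /= kD'.
have [|i ltin ij] := oD (size D, j).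
  by rewrite /is_point /= leqnn (level_last st) size_nseq.
by exists i => //; apply: (on_string_catr ij jk).
Qed.

End Concatenation.

Lemma string_link_nil n : string_link n [::].
Proof.
rewrite /string_link /= eqxx; apply/asboolP => -[[|k] p] //=.
by rewrite /is_point /level /= size_nseq => ltpn; exists p => //; exists 0.
Qed.

Definition dcat n (D D' : diagram n) : diagram n :=
  Diagram (string_link_cat (andP (layersP D)).1 (layersP D) (layersP D')).

Definition did n : diagram n := Diagram (string_link_nil n).

(* Planar isotopy fixing the boundary, for sliced diagrams: it is generated by
   height exchanges of pieces lying side by side, cancellations of a maximum
   with a minimum, and slides of a crossing through a maximum or a minimum. *)
Inductive planar_move : seq layer -> seq layer -> Prop :=
| interchange l g m h r : planar_move
    [:: Layer l g (m ++ pdom h ++ r); Layer (l ++ pcod g ++ m) h r]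
    [:: Layer (l ++ pdom g ++ m) h r; Layer l g (m ++ pcod h ++ r)]
| zigzag_right l a r : planar_move
    [:: Layer (l ++ [:: a]) (Cap (~~ a)) r; Layer l (Cup a) (a :: r)] [::]
| zigzag_left l a r : planar_move
    [:: Layer l (Cap a) (a :: r); Layer (l ++ [:: a]) (Cup (~~ a)) r] [::]
| slide_cup l ov a c r : planar_move
    [:: Layer l (Cross ov a c) (~~ a :: r); Layer (l ++ [:: c]) (Cup a) r]
    [:: Layer (l ++ [:: a]) (Cross (~~ ov) c (~~ a)) r; Layer l (Cup a) (c :: r)]
| slide_cap l ov a c r : planar_move
    [:: Layer (l ++ [:: c]) (Cap a) r; Layer l (Cross ov c a) (~~ a :: r)]
    [:: Layer l (Cap a) (c :: r); Layer (l ++ [:: a]) (Cross (~~ ov) (~~ a) c) r].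

Inductive reidemeister_move : seq layer -> seq layer -> Prop :=
| R1_right l ov a r : reidemeister_move
    [:: Layer (l ++ [:: a]) (Cap a) r; Layer l (Cross ov a a) (~~ a :: r);
        Layer (l ++ [:: a]) (Cup a) r] [::]
| R1_left l ov a r : reidemeister_move
    [:: Layer l (Cap (~~ a)) (a :: r); Layer (l ++ [:: ~~ a]) (Cross ov a a) r;
        Layer l (Cup (~~ a)) (a :: r)] [::]
| R2 l ov a b r : reidemeister_move
    [:: Layer l (Cross ov a b) r; Layer l (Cross (~~ ov) b a) r] [::]
  (* oab, oac, obc tell whether b passes over a, c over a and c over b; the
     hypothesis says that these relations are not cyclic *)
| R3 l oab oac obc a b c r of (oab == obc) ==> (oac == oab) : reidemeister_move
    [:: Layer l (Cross oab a b) (c :: r);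
        Layer (l ++ [:: b]) (Cross oac a c) r;
        Layer l (Cross obc b c) (a :: r)]
    [:: Layer (l ++ [:: a]) (Cross obc b c) r;
        Layer l (Cross oac a c) (b :: r);
        Layer (l ++ [:: c]) (Cross oab a b) r].

(* As D and D' are string link diagrams, a move only ever replaces A by a B
   with the same strands at its top and at its bottom. *)
Definition diagram_move n (D D' : diagram n) : Prop :=
  exists S T A B, [/\ planar_move A B \/ reidemeister_move A B,
    layers D = S ++ A ++ T & layers D' = S ++ B ++ T].

Definition equivalent n : diagram n -> diagram n -> Prop :=
  clos_refl_sym_trans (diagram n) (@diagram_move n).

Section StringLinks.
Context (n : nat).
Implicit Types D : diagram n.

Definition equivb D D' := `[< equivalent D D' >].
Fact equivb_refl : reflexive equivb.
Proof. by move=> D; apply/asboolP/rst_refl. Qed.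
Fact equivb_sym : symmetric equivb.
Proof. by move=> D D'; apply/asboolP/asboolP; apply: rst_sym. Qed.
Fact equivb_trans : transitive equivb.
Proof.
move=> D2 D1 D3 /asboolP e1 /asboolP e2; apply/asboolP.
exact: rst_trans e1 e2.
Qed.
Canonical diagram_equiv := EquivRel equivb equivb_refl equivb_sym equivb_trans.

Definition SL : Type := {eq_quot diagram_equiv}.
HB.instance Definition _ := Choice.on SL.
HB.instance Definition _ := EqQuotient.on SL.

Definition slclass D : SL := \pi_SL D.

Lemma slclassP D D' : slclass D = slclass D' <-> equivalent D D'.
Proof. by split=> [/eqmodP/asboolP|e]; last apply/eqmodP/asboolP. Qed.

Lemma slclass_repr x : slclass (repr x) = x. Proof. exact: reprK. Qed.

Lemma equivalent_cat D1 D2 D1' D2' : equivalent D1 D2 ->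
  equivalent D1' D2' -> equivalent (dcat D1 D1') (dcat D2 D2').
Proof.
move=> e e'; apply: (rst_trans _ _ _ (dcat D2 D1')).
  elim: e => {D1 D2}.
  - move=> D1 D2 [S [T [A [B [mAB E1 E2]]]]]; apply: rst_step.
    by exists S, (T ++ D1'), A, B; rewrite /= E1 E2 -!catA.
  - by move=> *; apply: rst_refl.
  - by move=> *; apply: rst_sym.
  - by move=> D1 D2 D3 _ H1 _ H2; apply: rst_trans H1 H2.
elim: e' => {D1' D2'}.
- move=> D1' D2' [S [T [A [B [mAB E1 E2]]]]]; apply: rst_step.
  by exists (D2 ++ S), T, A, B; rewrite /= E1 E2 -!catA.
- by move=> *; apply: rst_refl.
- by move=> *; apply: rst_sym.
- by move=> D1' D2' D3' _ H1 _ H2; apply: rst_trans H1 H2.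
Qed.

Definition slmul (x y : SL) : SL := slclass (dcat (repr x) (repr y)).

Lemma slmulE D D' : slmul (slclass D) (slclass D') = slclass (dcat D D').
Proof.
by apply/slclassP/equivalent_cat; apply/slclassP; rewrite slclass_repr.
Qed.

Fact slmulA : associative slmul.
Proof.
move=> x y z; rewrite -(slclass_repr x) -(slclass_repr y) -(slclass_repr z).
by rewrite !slmulE; congr slclass; apply/val_inj/catA.
Qed.
Fact slmul1 : left_id (slclass (did n)) slmul.
Proof.
move=> x; rewrite -(slclass_repr x) slmulE; congr slclass.
exact/val_inj.
Qed.
Fact slmulx1 : right_id (slclass (did n)) slmul.
Proof.
move=> x; rewrite -(slclass_repr x) slmulE; congr slclass.
exact/val_inj/cats0.
Qed.

HB.instance Definition _ := isMonoid.Build SL slmulA slmul1 slmulx1.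

End StringLinks.

Section TongYangMa.
Context (n : nat) (D : diagram n).

Definition point : Type := {x : nat * nat | is_point n D x}.
HB.instance Definition _ := Choice.on point.

Fact top_subproof (i : 'I_n) : is_point n D (0, val i).
Proof. by rewrite /is_point /level /= size_nseq ltn_ord. Qed.
Definition top_point (i : 'I_n) : point :=
  exist (fun x => is_point n D x) _ (top_subproof i).

Fact bot_subproof (j : 'I_n) : is_point n D (size D, val j).
Proof.
have /andP[/level_last st _] := layersP D.
by rewrite /is_point /= leqnn st size_nseq ltn_ord.
Qed.
Definition bot_point (j : 'I_n) : point :=
  exist (fun x => is_point n D x) _ (bot_subproof j).

(* The generators are the points at all levels.  Points on the same edge are
   identified, as the relations read next_point x = x there; so the generators amount
   to the n + 2N edges, and the other relations are those at the crossings. *)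
Definition Krel (x : point) (w : Lambda) (y : point) : Prop :=
  next_point n D (val x) = Some (val y) /\ w = exponent n D (val x).

Definition K : lambdaGroupType := presented Krel.

(* the index i_j of the string that ends at the j-th bottom point *)
Definition source (j : 'I_n) : 'I_n :=
  xget j [set i : 'I_n | on_string n D i (size D, val j)]%classic.

(* the element w_j of Lambda such that x_j = a_{i_j} ^ w_j in K *)
Definition wK (j : 'I_n) : Lambda :=
  xget 0 [set w : Lambda |
    pgen Krel (bot_point j) = lact (pgen Krel (top_point (source j))) w
      :> K]%classic.

(* inl i and inr j are the generators a_i and x_j *)
Inductive Ktrel : 'I_n + 'I_n -> Lambda -> 'I_n + 'I_n -> Prop :=
  KtRel j : let k := self_writhe n D (source j) in
    Ktrel (inl (source j)) (wK j - (upow k + vpow k)) (inr j).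

Definition Kt : lambdaGroupType := presented Ktrel.

Definition Sbasis (i : 'I_n) : ab Kt := abcl (pgen Ktrel (inl i) : Kt).
Definition Tbasis (j : 'I_n) : ab Kt := abcl (pgen Ktrel (inr j) : Kt).

(* The change of basis matrix M, with S M = T. *)
Definition TYM : 'M[ZLambda]_n :=
  xget 0 [set M : 'M[ZLambda]_n |
    forall j, Tbasis j = \sum_i M i j *: Sbasis i]%classic.

End TongYangMa.

Section GeneralLinear.
Context (n : nat).

Definition GL : Type := {A : 'M[ZLambda]_n | A \in unitmx}.
HB.instance Definition _ := Choice.on GL.
HB.instance Definition _ := SubType.on GL.

Definition GLmx (A : GL) : 'M[ZLambda]_n := val A.

Fact GLmul_subproof (A B : GL) : GLmx A *m GLmx B \in unitmx.
Proof. by rewrite unitmx_mul (valP A) (valP B). Qed.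
Fact GL1_subproof : (1%:M : 'M[ZLambda]_n) \in unitmx.
Proof. exact: unitmx1. Qed.
Fact GLinv_subproof (A : GL) : invmx (GLmx A) \in unitmx.
Proof. by rewrite unitmx_inv (valP A). Qed.

Definition GLmul (A B : GL) : GL := Sub (_ *m _) (GLmul_subproof A B).
Definition GL1 : GL := Sub 1%:M GL1_subproof.
Definition GLinv (A : GL) : GL := Sub (invmx _) (GLinv_subproof A).

Fact GLmulA : associative GLmul.
Proof. by move=> A B C; apply/val_inj/mulmxA. Qed.
Fact GLmul1 : left_id GL1 GLmul.
Proof. by move=> A; apply/val_inj/mul1mx. Qed.
Fact GLmulx1 : right_id GL1 GLmul.
Proof. by move=> A; apply/val_inj/mulmx1. Qed.
Fact GLmulVx : left_inverse GL1 GLinv GLmul.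
Proof. by move=> A; apply/val_inj/mulVmx/(valP A). Qed.
Fact GLmulxV : right_inverse GL1 GLinv GLmul.
Proof. by move=> A; apply/val_inj/mulmxV/(valP A). Qed.

HB.instance Definition _ := isGroup.Build GL
  GLmulA GLmul1 GLmulx1 GLmulVx GLmulxV.

End GeneralLinear.

(* Main.v *)
(* Colour the i-th string.  Each crossing of the coloured string with another
   one contributes u or v to the power of its sign, according to which of the
   two passes under.  A coloured diagram thus carries a weight, computed locally
   from the colours of the strands at each level, and each planar or Reidemeister
   move preserves the weight together with the colours at its top and bottom.
   On a string link the colours at the top determine all the others, because
   every point is joined to the top by a string.  So the weight and the end of
   the i-th string are invariant, and weights add under concatenation.

   The weight equals the exponent w_j (uv)^(-k_j) of the matrix entry: labelling
   the points of the string by the exponent accumulated from its start, the sum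
   of the labels over a level, signed by orientation, changes at each layer by
   the contributions of the crossings of the string there, since the two arms of
   a maximum or minimum cancel.  The two passages through a self-crossing
   contribute uv to the power of its sign, which is what k_j removes.  The w_j
   themselves and the matrix are pinned down by evaluating the presented
   Lambda-groups in Z[Lambda]. *)

Require Import Defs.
From HB Require Import structures.
From mathcomp Require Import all_boot all_order all_algebra.
From mathcomp Require Import finmap boolp classical_sets zify.
From mathcomp.multinomials Require Import monalg.

Set Implicit Arguments.
Unset Strict Implicit.
Unset Printing Implicit Defensive.

Import GRing.Theory.
Local Open Scope ring_scope.

(* The orientation of a strand, and whether it belongs to the chosen string. *)
Definition strand : Type := (bool * bool)%type.

(** * Local weights of coloured crossings *)

Definition csign (ov a b : bool) : int := if ov == (a == b) then 1 else -1.

(* p and q tell whether the strands of orientations a and b, in the notation of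
   Cross ov a b, belong to the chosen string. *)
Definition cweight (ov a b p q : bool) : Lambda :=
  let: (under, over) := if ov then (p, q) else (q, p) in
  (csign ov a b *+ (under && ~~ over), csign ov a b *+ (over && ~~ under)).

(** A passage counts only when the other strand has the other colour; so the kink removed by R1 is
    weightless. *)
Lemma cweight_self ov a b p : cweight ov a b p p = 0.
Proof. by case: ov a b p => [] [] [] []. Qed.

(** The two crossings of R2 have the same over-strand and opposite signs. *)
Lemma cweight_inv ov a b p q :
  cweight ov a b p q + cweight (~~ ov) b a q p = 0.
Proof. by case: ov a b p q => [] [] [] [] []. Qed.

(** Meeting the other arm of a turn reverses one orientation and swaps left and right; the two
    effects on the sign cancel, and the over-strand stays the same. *)
Lemma cweight_slide ov a b p q :
  cweight (~~ ov) b (~~ a) q p = cweight ov a b p q.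
Proof. by case: ov a b p q => [] [] [] [] []. Qed.

Lemma cweight_slide' ov a b p q :
  cweight (~~ ov) (~~ b) a q p = cweight ov a b p q.
Proof. by case: ov a b p q => [] [] [] [] []. Qed.

(** * Coloured diagrams *)

Inductive cpiece : piece -> seq strand -> seq strand -> Lambda -> Prop :=
| CCross ov a b p q : cpiece (Cross ov a b) [:: (a, p); (b, q)]
    [:: (b, q); (a, p)] (cweight ov a b p q)
| CCup a p : cpiece (Cup a) [:: (a, p); (~~ a, p)] [::] 0
| CCap a p : cpiece (Cap a) [::] [:: (a, p); (~~ a, p)] 0.

Inductive clayer : layer -> seq strand -> seq strand -> Lambda -> Prop :=
| CLayer l g r A x y B w : map fst A = l -> map fst B = r ->
    cpiece g x y w -> clayer (Layer l g r) (A ++ x ++ B) (A ++ y ++ B) w.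

Inductive crun : seq layer -> seq strand -> seq strand -> Lambda -> Prop :=
| crun_nil s : crun [::] s s 0
| crun_cons l D s r t w z : clayer l s r w -> crun D r t z ->
    crun (l :: D) s t (w + z).

Lemma crun_consP l D s t w : crun (l :: D) s t w ->
  exists r w1 w2, [/\ clayer l s r w1, crun D r t w2 & w = w1 + w2].
Proof. by move=> H; inversion H; subst; exists r, w0, z. Qed.

Lemma crun_catP D D' s t w : crun (D ++ D') s t w <->
  exists r w1 w2, [/\ crun D s r w1, crun D' r t w2 & w = w1 + w2].
Proof.
split.
  elim: D s w => [|l D IH] s w /=.
    by move=> H; exists s, 0, w; rewrite add0r; split=> //; apply: crun_nil.
  case/crun_consP=> r [w1 [_ [Hl /IH[r' [w2 [w3 [H2 H3 ->]]]] ->]]].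
  by exists r', (w1 + w2), w3; rewrite addrA; split=> //;
    apply: crun_cons Hl H2.
case=> r [w1 [w2 [H1 H2 ->]]].
elim: H1 H2 => {s r w1 D}[s|l D s r r' w1 z Hl _ IH] H2; first by rewrite add0r.
by rewrite -addrA /=; apply: crun_cons Hl (IH _).
Qed.

Lemma crun_nilP s t w : crun [::] s t w -> t = s /\ w = 0.
Proof. by move=> H; inversion H. Qed.

Lemma map_catP (T T' : Type) (f : T -> T') s a b : map f s = a ++ b ->
  exists s1 s2, [/\ s = s1 ++ s2, map f s1 = a & map f s2 = b].
Proof.
move=> E; exists (take (size a) s), (drop (size a) s).
by rewrite cat_take_drop map_take map_drop E take_size_cat // drop_size_cat.
Qed.

Lemma fst_consP (s : seq strand) a b : map fst s = a :: b ->
  exists q s', s = (a, q) :: s' /\ map fst s' = b.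
Proof. by case: s => //= -[a' q] s [<- <-]; exists q, s. Qed.

Lemma cat_inj (T : Type) (a a' b b' : seq T) :
  size a = size a' -> a ++ b = a' ++ b' -> a = a' /\ b = b'.
Proof. by elim: a a' => [|x a IH] [|x' a'] //= [/IH H] [-> /H [-> ->]]. Qed.

Lemma clayerP l g r s t w : clayer (Layer l g r) s t w ->
  exists A x y B, [/\ map fst A = l, map fst B = r, cpiece g x y w,
    s = A ++ x ++ B & t = A ++ y ++ B].
Proof. by move=> H; inversion H; subst; exists A, x, y, B. Qed.

(** The prefix [A] has the length of the left flank, which fixes how the level splits. This serves
    the later layers of a move, whose top level is already known. *)
Lemma clayer_catl A l g r s t w : map fst A = l ->
  clayer (Layer l g r) (A ++ s) t w -> exists x y B,
  [/\ map fst B = r, cpiece g x y w, s = x ++ B & t = A ++ y ++ B].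
Proof.
move=> Al /clayerP[A' [x [y [B [Al' Br gxy]]]]].
case/cat_inj => [|-> -> ->]; last by exists x, y, B.
by rewrite -(size_map fst A) Al -Al' size_map.
Qed.

Lemma cpiece_cross ov a b x y w : cpiece (Cross ov a b) x y w ->
  exists p q, [/\ x = [:: (a, p); (b, q)], y = [:: (b, q); (a, p)]
    & w = cweight ov a b p q].
Proof. by move=> H; inversion H; subst; exists p, q. Qed.

Lemma cpiece_cup a x y w : cpiece (Cup a) x y w ->
  exists p, [/\ x = [:: (a, p); (~~ a, p)], y = [::] & w = 0].
Proof. by move=> H; inversion H; subst; exists p. Qed.

Lemma cpiece_cap a x y w : cpiece (Cap a) x y w ->
  exists p, [/\ x = [::], y = [:: (a, p); (~~ a, p)] & w = 0].
Proof. by move=> H; inversion H; subst; exists p. Qed.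

Lemma cpiece_shape g x y w : cpiece g x y w ->
  map fst x = pdom g /\ map fst y = pcod g.
Proof. by case. Qed.

Lemma crun1 l s t w : clayer l s t w -> crun [:: l] s t w.
Proof. by move=> H; rewrite -[w]addr0; apply: crun_cons H (crun_nil _). Qed.

Lemma crun2 l1 l2 s r t w1 w2 : clayer l1 s r w1 -> clayer l2 r t w2 ->
  crun [:: l1; l2] s t (w1 + w2).
Proof. by move=> H1 /crun1; apply: crun_cons. Qed.

Lemma crun2P l1 l2 s t w : crun [:: l1; l2] s t w ->
  exists r w1 w2, [/\ clayer l1 s r w1, clayer l2 r t w2 & w = w1 + w2].
Proof.
case/crun_consP=> r [w1 [_ [H1 /crun_consP[r' [w2 [_ [H2 /crun_nilP[-> ->]
  ->]]]] ->]]].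
by exists r, w1, w2; rewrite addr0.
Qed.

Lemma crun3P l1 l2 l3 s t w : crun [:: l1; l2; l3] s t w ->
  exists r r' w1 w2 w3, [/\ clayer l1 s r w1, clayer l2 r r' w2,
    clayer l3 r' t w3 & w = w1 + w2 + w3].
Proof.
case/crun_consP=> r [w1 [_ [H1 /crun2P[r' [w2 [w3 [H2 H3 ->]]]] ->]]].
by exists r, r', w1, w2, w3; rewrite addrA.
Qed.

Lemma CLayer_eq A x y B g w s t l r : cpiece g x y w ->
   map fst A = l -> map fst B = r -> s = A ++ x ++ B -> t = A ++ y ++ B ->
   clayer (Layer l g r) s t w.
Proof. by move=> ? ? ? -> ->; constructor. Qed.

Lemma fst_rconsP (s : seq strand) a b : map fst s = b ++ [:: a] ->
  exists q s', s = s' ++ [:: (a, q)] /\ map fst s' = b.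
Proof.
move=> E; have [s1 [s2 [-> Es1 /fst_consP[q [s3 [-> Es3]]]]]] := map_catP E.
by case: s3 Es3 => // _; exists q, s1.
Qed.

Lemma crun_nil0 s t w : s = t -> w = 0 -> crun [::] s t w.
Proof. by move=> -> ->; constructor. Qed.

(** * Coloured runs under planar and Reidemeister moves *)

(** Inversion yields the colours inside [A], the arms of each turn agreeing in colour, and from
    these a run through [B] is built. One direction suffices, because [crun_det] makes runs on
    string link diagrams unique. *)
Lemma planar_move_crun A B s t w :
  planar_move A B -> crun A s t w -> crun B s t w.
Proof.
case=> [l g m h r|l a r|l a r|l ov a c r|l ov a c r]
  /crun2P[s' [w1 [w2 [H1 H2 ->]]]].
- have [L [x [y [R [EL ER gxy -> Es']]]]] := clayerP H1.
  have [M [R' [ERe EM /map_catP[x' [R'' [ERe' Ex' ER'']]]]]] := map_catP ER.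
  have [gx gy] := cpiece_shape gxy.
  rewrite Es' {}ERe {}ERe' in H2 *.
  (* The left flank of the second piece is regrouped so as to contain the outcome [y] of the
     first. *)
  have := H2; rewrite (_ : L ++ _ = (L ++ y ++ M) ++ x' ++ R'');
    last by rewrite -!catA.
  case/clayer_catl=> [|x0 [y' [R0 [ER0 hxy /cat_inj[|E1 E2 ->]]]]].
  + by rewrite !map_cat EL gy EM.
  + by rewrite -(size_map fst x') Ex' -(size_map fst x0) (cpiece_shape hxy).1.
  subst; rewrite addrC.
  apply: (@crun2 _ _ _ (L ++ x ++ M ++ y' ++ R0)).
    by apply: (@CLayer_eq (L ++ x ++ M) x0 y' R0) => //;
      rewrite ?map_cat -?catA ?gx.
  apply: (@CLayer_eq L x y (M ++ y' ++ R0)) => //; rewrite ?map_cat -?catA //.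
  by rewrite (cpiece_shape hxy).2.
- have [_ [_ [_ [R [/fst_rconsP[q [L [-> EL]]] ER /cpiece_cap[p [-> ->
    ->]] -> Es']]]]] := clayerP H1.
  rewrite Es' -!catA /= in H2.
  have [_ [_ [B' [_ /cpiece_cup[p' [-> -> ->]] [<- -> <-] ->]]]] :=
    clayer_catl EL H2.
  (* The minimum equates the colour of the incoming strand with that of the maximum. *)
  by apply: crun_nil0; rewrite ?addr0 // -catA ?negbK.
- have [L [_ [_ [_ [EL /fst_consP[q [R [-> ER]]] /cpiece_cap[p [-> ->
    ->]] -> Es']]]]] := clayerP H1.
  rewrite Es' /= -(cat1s (a, p)) catA /= in H2.
  have [|_ [_ [B' [_ /cpiece_cup[p' [-> -> ->]] [-> _ -> <-] ->]]]] :=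
    clayer_catl _ H2.
    by rewrite map_cat EL.
  by apply: crun_nil0; rewrite ?addr0 // -catA ?negbK.
- have [L [_ [_ [_ [EL /fst_consP[q [R [-> ER]]] /cpiece_cross[p [p' [-> ->
    ->]]] -> Es']]]]] := clayerP H1.
  rewrite Es' /= -(cat1s (c, p')) catA /= in H2.
  have [|_ [_ [B' [_ /cpiece_cup[z [-> -> ->]] [-> -> <-] ->]]]] :=
    clayer_catl _ H2.
    by rewrite map_cat EL.
  (* Below the moved crossing the arms of the minimum are adjacent and the strand [c] lies to their
     right. *)
  rewrite -cweight_slide; apply: (@crun2 _ _ _ (L ++ [:: (a, z); (~~ a, z);
    (c, p')] ++ R)).
    by apply: (CLayer_eq (A := L ++ [:: (a, z)]) (B := R) (CCross _ _ _ _ _));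
      rewrite /= ?map_cat ?EL ?ER -?catA.
  by apply: (CLayer_eq (A := L) (B := ((c, p') :: R)) (CCup _ _));
    rewrite /= ?map_cat ?EL ?ER -?catA.
- have [_ [_ [_ [R [/fst_rconsP[q [L [-> EL]]] ER /cpiece_cap[p [-> ->
    ->]] -> Es']]]]] := clayerP H1.
  rewrite Es' -!catA /= in H2.
  have [_ [_ [B' [_ /cpiece_cross[p1 [p2 [-> -> ->]]] [<- <- <-] ->]]]] :=
    clayer_catl EL H2.
  rewrite -cweight_slide' addrC addr0 -[cweight _ _ _ _ _]add0r.
  apply: (@crun2 _ _ _ (L ++ [:: (a, p); (~~ a, p); (c, q)] ++ R)).
    by apply: (CLayer_eq (A := L) (B := ((c, q) :: R)) (CCap _ _));
      rewrite /= ?map_cat ?EL ?ER -?catA.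
  by apply: (CLayer_eq (A := L ++ [:: (a, p)]) (B := R) (CCross _ _ _ _ _));
    rewrite /= ?map_cat ?EL ?ER -?catA.
Qed.

(** In R1 the crossing strands have one colour, in R2 the two weights cancel, and in R3 each pair of
    strands crosses once on either side, with the same orientations, colours and over-strand. *)
Lemma reidemeister_move_crun A B s t w :
  reidemeister_move A B -> crun A s t w -> crun B s t w.
Proof.
case=> [l ov a r|l ov a r|l ov a b r|l oab oac obc a b c r _].
- case/crun3P=> s1 [s2 [w1 [w2 [w3 [H1 H2 H3 ->]]]]].
  have [_ [_ [_ [R [/fst_rconsP[q [L [-> EL]]] ER /cpiece_cap[p [-> ->
    ->]] -> Es1]]]]] := clayerP H1.
  rewrite Es1 -!catA /= in H2.
  have [_ [_ [B2 [_ /cpiece_cross[p1 [p2 [-> -> ->]]] [<- <- <-] Es2]]]] :=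
    clayer_catl EL H2.
  rewrite Es2 /= -(cat1s (a, p)) catA /= in H3.
  have [|_ [_ [B' [_ /cpiece_cup[z [-> -> ->]] [-> -> <-] ->]]]] :=
    clayer_catl _ H3.
    by rewrite map_cat EL.
  by apply: crun_nil0 => //; rewrite cweight_self !addr0.
- case/crun3P=> s1 [s2 [w1 [w2 [w3 [H1 H2 H3 ->]]]]].
  have [L [_ [_ [_ [EL /fst_consP[q [R [-> ER]]] /cpiece_cap[p [-> ->
    ->]] -> Es1]]]]] := clayerP H1.
  rewrite Es1 /= -(cat1s (~~ a, p)) catA /= negbK in H2.
  have [|_ [_ [B2 [_ /cpiece_cross[p1 [p2 [-> -> ->]]] [<- <- <-] Es2]]]] :=
    clayer_catl _ H2.
    by rewrite map_cat EL.
  rewrite Es2 -!catA /= in H3.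
  have [_ [_ [B' [_ /cpiece_cup[z [-> -> ->]] [-> _ -> <-] ->]]]] :=
    clayer_catl EL H3.
  by apply: crun_nil0 => //; rewrite cweight_self !addr0.
- case/crun2P=> s1 [w1 [w2 [H1 H2 ->]]].
  have [L [_ [_ [R [EL ER /cpiece_cross[p [p' [-> -> ->]]] -> Es1]]]]] :=
    clayerP H1.
  rewrite Es1 in H2.
  have [_ [_ [B' [_ /cpiece_cross[z [z' [-> -> ->]]] [<- <- <-] ->]]]] :=
    clayer_catl EL H2.
  by apply: crun_nil0 => //; rewrite cweight_inv.
case/crun3P=> s1 [s2 [w1 [w2 [w3 [H1 H2 H3 ->]]]]].
have [L [_ [_ [_ [EL /fst_consP[r3 [R [-> ER]]] /cpiece_cross[p [q [-> ->
  ->]]] -> Es1]]]]] := clayerP H1.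
rewrite Es1 /= -(cat1s (b, q)) catA /= in H2.
have [|_ [_ [B2 [_ /cpiece_cross[p1 [p2 [-> -> ->]]] [<- <- <-] Es2]]]] :=
  clayer_catl _ H2.
  by rewrite map_cat EL.
rewrite Es2 -!catA /= in H3.
have [_ [_ [B' [_ /cpiece_cross[z [z' [-> -> ->]]] [<- <- <-] ->]]]] :=
  clayer_catl EL H3.
(* The other side of R3 meets the three crossings in the opposite order. *)
rewrite [_ + cweight obc _ _ _ _]addrC [cweight oab _ _ _ _ + _]addrC.
apply: (@crun_cons _ _ _ (L ++ [:: (a, p); (c, r3); (b, q)] ++ R)).
  by apply: (CLayer_eq (A := L ++ [:: (a, p)]) (B := R) (CCross _ _ _ _ _));
    rewrite /= ?map_cat ?EL ?ER -?catA.
apply: (@crun2 _ _ _ (L ++ [:: (c, r3); (a, p); (b, q)] ++ R)).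
  by apply: (CLayer_eq (A := L) (B := ((b, q) :: R)) (CCross _ _ _ _ _));
    rewrite /= ?map_cat ?EL ?ER -?catA.
by apply: (CLayer_eq (A := L ++ [:: (c, r3)]) (B := R) (CCross _ _ _ _ _));
  rewrite /= ?map_cat ?EL ?ER -?catA.
Qed.

(** * Following a string *)

Definition lside (l : layer) (b : bool) : seq bool :=
  if b then ltop l else lbot l.
Definition pside (g : piece) (b : bool) : seq bool :=
  if b then pdom g else pcod g.

Lemma lsideE L g R b : lside (Layer L g R) b = L ++ pside g b ++ R.
Proof. by case: b. Qed.

Definition is_cross g := if g is Cross _ _ _ then true else false.

Lemma through_left L g R b p : (p < size L)%N ->
  through (Layer L g R) b p = (~~ b, p).
Proof. by rewrite /through /= => ->. Qed.

(** Crossings and turns both exchange the positions 0 and 1; a crossing leads to the opposite side,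
    a turn back to the same side. *)
Lemma through_mid L g R b i : (i < size (pside g b))%N ->
  through (Layer L g R) b (size L + i) = (is_cross g != b, size L + (1 - i))%N.
Proof.
move=> Hi; rewrite /through /= ltnNge leq_addr /= ltn_add2l.
have -> : (i < size (if b then pdom g else pcod g))%N by case: b Hi.
by rewrite addKn; case: g {Hi}; case: b.
Qed.

Lemma through_right L g R b j :
  through (Layer L g R) b (size L + (size (pside g b) + j)) =
  (~~ b, size L + (size (pside g (~~ b)) + j))%N.
Proof.
rewrite /through /= ltnNge leq_addr /= ltn_add2l ltnNge.
have -> : size (if b then pdom g else pcod g) = size (pside g b) by case: b.
have -> : size (if b then pcod g else pdom g) = size (pside g (~~ b)) by case:
  b.
by rewrite leq_addr /= (addnA (size L)) -addnA; congr pair; lia.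
Qed.

Variant side_pos (L : seq bool) g (R : seq bool) b : nat -> Prop :=
| SideLeft p of (p < size L)%N : side_pos L g R b p
| SideMid i of (i < size (pside g b))%N : side_pos L g R b (size L + i)
| SideRight j of (j < size R)%N : side_pos L g R b (size L + (size (pside g b)
  + j)).

Lemma sideP L g R b p : (p < size (lside (Layer L g R) b))%N ->
  side_pos L g R b p.
Proof.
rewrite lsideE !size_cat; case: (ltnP p (size L)) => [|Hp];
  first by constructor.
rewrite -(subnKC Hp) ltn_add2l; move: (p - size L)%N => i.
case: (ltnP i (size (pside g b))) => [|Hi]; first by constructor.
by rewrite -(subnKC Hi) ltn_add2l; constructor.
Qed.

Lemma nth_left (T : Type) (x : T) L M R p : (p < size L)%N ->
  nth x (L ++ M ++ R) p = nth x L p.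
Proof. by rewrite nth_cat => ->. Qed.
Lemma nth_mid (T : Type) (x : T) L M R i : (i < size M)%N ->
  nth x (L ++ M ++ R) (size L + i) = nth x M i.
Proof. by move=> Hi; rewrite nth_cat ltnNge leq_addr /= addKn nth_cat Hi. Qed.
Lemma nth_right (T : Type) (x : T) L M R j :
  nth x (L ++ M ++ R) (size L + (size M + j)) = nth x R j.
Proof. by rewrite nth_cat ltnNge leq_addr /= addKn nth_cat ltnNge leq_addr /=
  addKn. Qed.

(** Traversal is reversible, and the vertical direction of a strand flips exactly when it leaves by
    the side where it entered. *)
Lemma throughP l b p c q : (p < size (lside l b))%N -> through l b p = (c, q) ->
  [/\ (q < size (lside l c))%N, through l c q = (b, p)
    & nth true (lside l c) q = (nth true (lside l b) p == (c != b))].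
Proof.
case: l => L g R /sideP[{}p Hp|i Hi|j Hj].
- rewrite through_left // => -[<- <-];
    rewrite !lsideE through_left // !nth_left //.
  rewrite negbK size_cat ltn_addr //; split=> //;
    by case: b (nth _ _ _) => [] [].
- rewrite through_mid // => -[<- <-].
  have Hi' : (1 - i < size (pside g (is_cross g != b)))%N.
    by case: g b i Hi => [??? []|? []|? []] [|[|?]].
  rewrite !lsideE through_mid // !nth_mid // !size_cat ltn_add2l ltn_addr //.
  by split=> //; case: g b i Hi {Hi'} => [? [] [] []|[] []|[] []] [|[|?]].
rewrite through_right // => -[<- <-].
rewrite !lsideE through_right negbK !nth_right !size_cat !ltn_add2l Hj;
  split=> //.
by case: b (nth _ _ _) => [] [].
Qed.

(** Layer [k] lies between the levels [k] and [k.+1]. *)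
Definition at_side (k : nat) (b : bool) : nat := if b then k else k.+1.

Lemma stack_side s D t k b : stack s D t -> (k < size D)%N ->
  nth [::] (s :: map lbot D) (at_side k b) = lside (nth layer0 D k) b.
Proof.
elim: D s k => [|l D IH] s [|k] //= /andP[/eqP El Hs] Hk.
  by case: {IH} b.
by rewrite -(IH _ _ Hs Hk); case: {IH} b.
Qed.

Section Points.
Context (n : nat) (D : seq layer).
Hypothesis st : stack (ends n) D (ends n).

Lemma level_side k b : (k < size D)%N ->
  level n D (at_side k b) = lside (nth layer0 D k) b.
Proof. exact: stack_side st. Qed.

(** A strand points into a layer when it is downward at the top or upward at the bottom, that is,
    when its orientation equals the side [b]. *)
Lemma next_ingoing k b p : (k < size D)%N ->
  nth true (lside (nth layer0 D k) b) p = b ->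
  next_point n D (at_side k b, p) =
  let: (c, q) := through (nth layer0 D k) b p in Some (at_side k c, q).
Proof.
move=> kD Hb; rewrite /next_point /entered /downward /= level_side // Hb.
by case: b {Hb} => /=; rewrite ?kD /=; case: through.
Qed.

(* The arc from x to y crosses layer k from side b to side c (true = top). *)
Variant next_spec x y : Prop :=
| NextSpec k b p c q of (k < size D)%N & x = (at_side k b,
  p) & y = (at_side k c, q)
  & nth true (lside (nth layer0 D k) b) p = b & nth true (lside (nth layer0 D
    k) c) q = ~~ c
  & (p < size (lside (nth layer0 D k) b))%N
  & (q < size (lside (nth layer0 D k) c))%N
  & through (nth layer0 D k) b p = (c, q)
  & through (nth layer0 D k) c q = (b, p).

Lemma nextP x y : is_point n D x -> next_point n D x = Some y -> next_spec x y.
Proof.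
case: x => h p /andP[/= hD hp] Hn.
pose b := downward n D (h, p).
have [k kD Eh] : exists2 k, (k < size D)%N & h = at_side k b.
  move: Hn; rewrite /next_point /entered -/b /=; case: b;
    first by case: ltnP => // hD' _; exists h.
  by case: h {hp} hD => // h hD _; exists h.
have Eb : nth true (lside (nth layer0 D k) b) p = b by rewrite -level_side //
  -Eh.
move: Hn; rewrite {1}Eh next_ingoing //; case E: through => [c q] [<-].
rewrite Eh level_side // in hp.
have [Hq E' Ho] := throughP hp E.
apply: (@NextSpec _ _ k b p c q) => //; rewrite ?Eh // Ho Eb;
  by case: (b) (c) => [] [].
Qed.

Lemma next_is_point x y : is_point n D x -> next_point n D x = Some y ->
  is_point n D y.
Proof.
move=> Hx /(nextP Hx)[k b p c q kD _ -> _ _ _ Hq _ _].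
rewrite /is_point /= level_side // Hq andbT.
by case: c {Hq} => //=; apply: ltnW.
Qed.

Lemma next_inj x x' y : is_point n D x -> is_point n D x' ->
  next_point n D x = Some y -> next_point n D x' = Some y -> x = x'.
Proof.
move=> Hx Hx' /(nextP Hx)[k b p c q kD -> -> _ oc _ _ _ E].
case/(nextP Hx')=> k' b' p' c' q' kD' -> [Ek <-] _ oc' _ _ _ E'.
(* The orientation of [y] shows by which side the arc leaves its layer, hence which layer it is;
   there the arc is traced back. *)
have Ec : c = c'.
  by apply: negb_inj; rewrite -oc -oc' -!level_side // Ek.
subst c'; have Ekk : k' = k by move: Ek; case: (c) => [|[]].
by subst k'; move: E'; rewrite E => -[-> ->].
Qed.

(** Strands point downwards at level 0, whereas an arc arriving there would point upwards. *)
Lemma next_top x i : is_point n D x -> (i < n)%N ->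
  next_point n D x <> Some (0, i).
Proof.
move=> Hx ltin /(nextP Hx)[k b p c q kD _ [E <-] _ oc _ _ _ _].
have : level n D (at_side k c) = ends n by rewrite -E.
by rewrite level_side // => Es; rewrite Es nth_nseq if_same in oc;
  case: c {Es} oc E.
Qed.

Definition trajectory i m := iter m (obind (next_point n D)) (Some (0, i)).

Lemma trajectoryS i m : trajectory i m.+1 = obind (next_point n D) (trajectory
  i m).
Proof. by []. Qed.

Lemma trajectory_point i m x : (i < n)%N -> trajectory i m = Some x ->
  is_point n D x.
Proof.
move=> ltin; elim: m x => [|m IH] x /=.
  by case=> <-; rewrite /is_point /level /= size_nseq.
case E: trajectory => [y|//] /=.
by apply: next_is_point; apply: IH.
Qed.

(** Two paths that meet are followed back in step by [next_inj], and by [next_top] they reach the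
    top simultaneously. *)
Lemma trajectory_inj i i' m m' x : (i < n)%N -> (i' < n)%N ->
  trajectory i m = Some x -> trajectory i' m' = Some x -> i = i' /\ m = m'.
Proof.
move=> lti lti'; elim: m m' x => [|m IH] [|m'] x.
- by case=> <- [].
- case=> <-; rewrite trajectoryS; case E: trajectory => [y|//] /= Hy.
  by case: (next_top (trajectory_point lti' E) lti Hy).
- move=> Hy [Ex]; move: Hy; rewrite -{}Ex trajectoryS.
  case E: trajectory => [y|//] /= Hy.
  by case: (next_top (trajectory_point lti E) lti' Hy).
rewrite !trajectoryS; case E: trajectory => [y|//] /= Hy.
case E': trajectory => [y'|//] /= Hy'.
have Ey : y = y'.
  by apply: next_inj Hy Hy'; [apply: trajectory_point E|apply: trajectory_point
    E'].
by rewrite -Ey in E'; have [-> ->] := IH _ _ E E'.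
Qed.

Lemma on_string_unique i i' x : (i < n)%N -> (i' < n)%N ->
  on_string n D i x -> on_string n D i' x -> i = i'.
Proof. by move=> lti lti' [m E] [m' E'];
  case: (trajectory_inj lti lti' E E'). Qed.

Lemma on_string_next i x y : (i < n)%N -> is_point n D x ->
  next_point n D x = Some y ->
  on_string n D i y <-> on_string n D i x.
Proof.
move=> ltin Hx Hn; split=> [] [m E]; last by exists m.+1; rewrite /= E.
case: m E => [|m]; first by case=> E; case: (next_top Hx ltin); rewrite E.
rewrite -/(trajectory i m.+1) trajectoryS; case E: trajectory => [z|//] /= Hz.
exists m; rewrite -/(trajectory i m) E.
by congr Some; apply: next_inj Hz Hn => //; apply: trajectory_point E.
Qed.

End Points.

(** * Uniqueness of colourings *)

Definition start (n i : nat) : seq strand :=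
  [seq (true, p == i) | p <- iota 0 n].

Definition colour (s : seq strand) (p : nat) : bool :=
  (nth (true, false) s p).2.

Lemma clayer_side l s t w b : clayer l s t w ->
  map fst (if b then s else t) = lside l b.
Proof.
case: l => L g R /clayerP[A [x [y [B [<- <- /cpiece_shape[gx gy] -> ->]]]]].
by rewrite lsideE; case: b; rewrite !map_cat ?gx ?gy.
Qed.

Lemma clayer_through l s t w b p c q : clayer l s t w ->
  (p < size (lside l b))%N -> through l b p = (c, q) ->
  colour (if c then s else t) q = colour (if b then s else t) p.
Proof.
case: l => L g R /clayerP[A [x [y [B [EL ER gxy -> ->]]]]].
have sA : size L = size A by rewrite -EL size_map.
have side e : (if e then A ++ x ++ B else A ++ y ++ B) = A ++ (if e then x else
  y) ++ B.
  by case: e.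
have sx e : size (pside g e) = size (if e then x else y).
  by case: e; have [gx gy] := cpiece_shape gxy; rewrite /= -?gx -?gy size_map.
rewrite /colour !side; case/sideP=> [{}p Hp|k Hk|k _].
- by rewrite through_left // => -[_ <-]; rewrite sA in Hp; rewrite !nth_left.
- have Hk' : (1 - k < size (pside g (is_cross g != b)))%N.
    by case: g {gxy sx} b k Hk => [??? []|? []|? []] [|[|?]].
  rewrite through_mid // => -[<- <-]; rewrite sA !nth_mid -?sx //.
  by case: gxy k Hk {Hk' sx side} => [????? | ?? | ??]; case: b => -[|[|?]].
by rewrite through_right // => -[<- <-]; rewrite sA !sx !nth_right.
Qed.

Lemma clayer_weight l s t t' w w' : clayer l s t w -> clayer l s t' w' ->
  w = w'.
Proof.
case: l => L g R /clayerP[A [x [y [B [EL _ gxy -> _]]]]].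
case/(clayer_catl EL) => x' [y' [B' [_ gxy' Ex _]]].
case: gxy gxy' Ex => [ov a b p q|a p|a p].
- by case/cpiece_cross=> p' [q' [-> _ ->]] [-> ->].
- by case/cpiece_cup=> p' [].
by case/cpiece_cap=> p' [].
Qed.

Lemma crun_levels D s t w : crun D s t w -> exists c wt,
  [/\ c 0 = s, c (size D) = t, forall k, (k < size D)%N ->
      clayer (nth layer0 D k) (c k) (c k.+1) (wt k)
    & w = \sum_(k < size D) wt k].
Proof.
elim=> {D s t w} [s|l D s r t w z Hl _ [c [wt [c0 ct Hc ->]]]].
  by exists (fun=> s), (fun=> 0); rewrite big_ord0.
exists (fun k => if k is k'.+1 then c k' else s), (fun k =>
  if k is k'.+1 then wt k' else w).
split=> //; last by rewrite big_ord_recl.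
by case=> [|k] Hk /=; [rewrite c0|apply: Hc].
Qed.

Lemma levels_crun D (c : nat -> seq strand) (wt : nat -> Lambda) :
  (forall k, (k < size D)%N -> clayer (nth layer0 D k) (c k) (c k.+1) (wt k)) ->
  crun D (c 0) (c (size D)) (\sum_(k < size D) wt k).
Proof.
elim: D c wt => [|l D IH] c wt Hc; first by rewrite big_ord0; constructor.
rewrite big_ord_recl; apply: crun_cons (Hc 0 isT) _.
apply: (IH (fun k => c k.+1) (fun k => wt k.+1)) => k Hk; exact: (Hc k.+1).
Qed.

(** The algebraic intersection number of the coloured strands with a level. *)
Definition degree (s : seq strand) : int :=
  \sum_(x <- s) (if x.2 then if x.1 then 1 else -1 else 0).

Lemma crun_degree D s t w : crun D s t w -> degree s = degree t.
Proof.
elim=> {D s t w} // l D s r t w z + _ <-.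
case: l => L g R /clayerP[A [x [y [B [_ _ gxy -> ->]]]]].
rewrite /degree !big_cat /=; congr (_ + (_ + _)).
case: gxy => [ov a b p q|a p|a p]; rewrite ?big_cons big_nil //=.
- by rewrite !addr0 addrC.
- by case: p a => [] [].
by case: p a => [] [].
Qed.

Section Determinism.
Context (n : nat) (D : seq layer).
Hypothesis st : stack (ends n) D (ends n).

Lemma levels_shape (c : nat -> seq strand) (wt : nat -> Lambda) k :
  map fst (c 0) = ends n -> (forall k, (k < size D)%N ->
      clayer (nth layer0 D k) (c k) (c k.+1) (wt k)) ->
  (k <= size D)%N -> map fst (c k) = level n D k.
Proof.
move=> c0 Hc; case: k => [//|k Hk].
by rewrite (level_side st false) // -(clayer_side false (Hc k Hk)).
Qed.

Lemma levels_colour (c : nat -> seq strand) (wt : nat -> Lambda) i i' x :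
  c 0 = start n i -> (forall k, (k < size D)%N ->
      clayer (nth layer0 D k) (c k) (c k.+1) (wt k)) ->
  (i' < n)%N -> on_string n D i' x -> colour (c x.1) x.2 = (i' == i).
Proof.
move=> c0 Hc lti [m]; rewrite -/(trajectory n D i' m).
elim: m x => [|m IH] x.
  by case=> <-; rewrite /= c0 /colour /start (nth_map 0) ?size_iota ?nth_iota.
rewrite trajectoryS; case E: trajectory => [y|//] /=.
case/(nextP st (trajectory_point st lti E))=> k b p e q kD Ey -> _ _ Hp _ Ht _.
rewrite -(IH _ E) Ey /=.
have := clayer_through (Hc k kD) Hp Ht.
by case: (b) (e) => [] [].
Qed.

Hypothesis tr : forall x, is_point n D x ->
  exists2 i, (i < n)%N & on_string n D i x.

Lemma start_ends i : map fst (start n i) = ends n.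
Proof.
rewrite /start -map_comp (@eq_map _ _ _ (fun=> true)) //.
by apply: (@eq_from_nth _ true); rewrite ?size_map size_iota ?size_nseq //
  => k Hk; rewrite nth_nseq Hk (nth_map 0) // size_iota.
Qed.

(** By [tr] each point is joined to the top by a string, along which the colour is constant; a
    closed component could be coloured freely. The colours determine the weights. *)
Lemma crun_det i t t' w w' : crun D (start n i) t w ->
  crun D (start n i) t' w' ->
  t = t' /\ w = w'.
Proof.
case/crun_levels=> c [wt [c0 <- Hc ->]] /crun_levels[c' [wt' [c0' <- Hc' ->]]].
have E k : (k <= size D)%N -> c k = c' k.
  move=> Hk.
  have s0 : map fst (c 0) = ends n by rewrite c0 start_ends.
  have s0' : map fst (c' 0) = ends n by rewrite c0' start_ends.
  have S := levels_shape s0 Hc Hk.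
  have S' := levels_shape s0' Hc' Hk.
  have Sz : size (c k) = size (level n D k) by rewrite -S size_map.
  have Sz' : size (c' k) = size (level n D k) by rewrite -S' size_map.
  apply: (@eq_from_nth _ (true, false)) => [|p Hp]; first by rewrite Sz.
  rewrite [LHS]surjective_pairing [RHS]surjective_pairing.
  rewrite -!(nth_map _ true fst) ?Sz' -?Sz // S S'; congr pair.
  have [|j ltj Hj] := tr (x := (k, p)); first by rewrite /is_point /= Hk -Sz.
  have := levels_colour c0 Hc ltj Hj; rewrite -(levels_colour c0' Hc' ltj Hj).
  exact.
split; first exact: E.
apply: eq_bigr => k _; have Hk := ltn_ord k.
have := Hc k Hk; rewrite (E k (ltnW Hk)) => H.
exact: clayer_weight H (Hc' k Hk).
Qed.

End Determinism.

(** * Accumulated exponents *)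

Definition lsign (l : layer) : int :=
  if lpiece l is Cross ov a b then csign ov a b else 0.

(** The layerwise form of [exponent], for a strand entering from side [b]. *)
Definition lexp (l : layer) (b : bool) (p : nat) : Lambda :=
  let m := size (lleft l) in
  if lpiece l is Cross ov _ _ then
    if (m <= p < m + 2)%N then
      if ((p == m.+1) == b) == ov then vpow (lsign l) else upow (lsign l)
    else 0
  else 0.

Lemma exponent_side n D k b p : stack (ends n) D (ends n) -> (k < size D)%N ->
  nth true (lside (nth layer0 D k) b) p = b ->
  exponent n D (at_side k b, p) = lexp (nth layer0 D k) b p.
Proof.
move=> st kD Hb; rewrite /exponent /passage /entered /downward /= (level_side
  st) // Hb.
have -> : (if b then if (at_side k b < size D)%N then Some (at_side k b) else
  None
    else if (0 < at_side k b)%N then Some (at_side k b).-1 else None) = Some k.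
  by case: b {Hb} => //=; rewrite kD.
rewrite /lexp /lsign /crossing_sign /csign; case: (lpiece _) => // ov a c.
by case: ifP => // _; case: (_ == ov).
Qed.

(* The sign makes the arms of a maximum or minimum cancel: see flow_turn. *)
Definition flow (a : bool) (x : bool * Lambda) : Lambda :=
  if x.1 then if a then x.2 else - x.2 else 0.

Lemma flow_through a (x y : bool * Lambda) (e : Lambda) :
  (if a then y = (x.1, x.2 + (if x.1 then e else 0))
   else x = (y.1, y.2 + (if y.1 then e else 0))) ->
  y.1 = x.1 /\ flow a y = flow a x + (if x.1 then e else 0).
Proof.
rewrite /flow; case: a => -> /=; split=> //; case: ifP => E;
  rewrite ?E ?addr0 //.
by rewrite opprD subrK.
Qed.

Lemma flow_turn a x : flow a x + flow (~~ a) x = 0.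
Proof.
by rewrite /flow; case: x => [[] w]; case: a => /=;
  rewrite ?addr0 ?subrr // addNr.
Qed.

Definition gain (s : seq (strand * Lambda)) : Lambda :=
  \sum_(x <- s) flow x.1.1 (x.1.2, x.2).

Lemma gain_cat s t : gain (s ++ t) = gain s + gain t.
Proof. exact: big_cat. Qed.

Definition lweight (l : layer) (p q : bool) : Lambda :=
  if lpiece l is Cross ov a b then cweight ov a b p q else 0.

(* lab b p is the label (colour, exponent) at position p on side b. *)
Section Layer.
Context (L : seq bool) (g : piece) (R : seq bool) (lab : bool -> nat ->
  bool * Lambda).
Let l := Layer L g R.
Let m := size L.
Hypothesis lab_through : forall b p c q, (p < size (lside l b))%N ->
  nth true (lside l b) p = b -> through l b p = (c, q) ->
  lab c q = ((lab b p).1, (lab b p).2 + (if (lab b p).1 then lexp l b p else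
    0)).

Definition labelled (b : bool) : seq (strand * Lambda) :=
  [seq ((nth true (lside l b) p, (lab b p).1), (lab b p).2)
     | p <- iota 0 (size (lside l b))].

Lemma lexp_left b p : (p < m)%N -> lexp l b p = 0.
Proof. by rewrite /lexp /= -/m => H; case: g => // *; rewrite leqNgt H. Qed.

Lemma lexp_right b j : lexp l b (m + (size (pside g b) + j)) = 0.
Proof.
rewrite /lexp /= -/m; case: g => // *; rewrite ltn_add2l ltnNge.
by case: b; rewrite leq_addr andbF.
Qed.

Lemma lexp_mid ov a c b i : g = Cross ov a c -> (i < 2)%N ->
  lexp l b (m + i) =
  if ((i == 1%N) == b) == ov then vpow (csign ov a c) else upow (csign ov a c).
Proof.
move=> Eg Hi; rewrite /lexp /lsign /= Eg -/m leq_addr ltn_add2l Hi /=.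
by rewrite -addn1 eqn_add2l.
Qed.

Lemma lab_left p : (p < m)%N -> lab true p = lab false p.
Proof.
move=> Hp; have side b : nth true (lside l b) p = nth true L p.
  by rewrite lsideE nth_left.
have Hp' b : (p < size (lside l b))%N.
  by rewrite lsideE size_cat ltn_addr.
have th b : through l b p = (~~ b, p).
  by rewrite through_left.
(* [lab_through] applies only along the orientation, so the side of entry depends on it. *)
case E: (nth true L p).
  rewrite (lab_through (Hp' true) _ (th true)) ?side // lexp_left // if_same
    addr0.
  by case: (lab true p).
rewrite (lab_through (Hp' false) _ (th false)) ?side // lexp_left // if_same
  addr0.
by case: (lab false p).
Qed.

Lemma lab_right j : (j < size R)%N ->
  lab true (m + (size (pdom g) + j)) = lab false (m + (size (pcod g) + j)).
Proof.
move=> Hj; pose P b := (m + (size (pside g b) + j))%N.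
have side b : nth true (lside l b) (P b) = nth true R j.
  by rewrite /P lsideE nth_right.
have HP b : (P b < size (lside l b))%N.
  by rewrite /P lsideE !size_cat !ltn_add2l.
have th b : through l b (P b) = (~~ b, P (~~ b)).
  by rewrite /P through_right.
rewrite -[LHS]/(lab true (P true)) -[RHS]/(lab false (P false)).
case E: (nth true R j).
  rewrite (lab_through (HP true) _ (th true)) ?side // lexp_right // if_same
    addr0.
  by case: (lab true _).
rewrite (lab_through (HP false) _ (th false)) ?side // lexp_right // if_same
  addr0.
by case: (lab false _).
Qed.

(** The flanks [A] and [B] are common to both sides, so only the piece can change the gain. *)
Lemma labelledE : exists A B, forall b, labelled b = A ++
  [seq ((nth true (pside g b) p, (lab b (m + p)).1), (lab b (m + p)).2)
    | p <- iota 0 (size (pside g b))] ++ B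
  /\ map (fst \o fst) A = L /\ map (fst \o fst) B = R.
Proof.
pose f b p : strand * Lambda := ((nth true (lside l b) p, (lab b p).1),
  (lab b p).2).
exists [seq f true p | p <- iota 0 m].
exists [seq f true (m + (size (pdom g) + j)) | j <- iota 0 (size R)].
move=> b; split; last split.
- rewrite /labelled -/(f b).
  have -> : size (lside l b) = (m + (size (pside g b) + size R))%N.
    by rewrite lsideE !size_cat.
  rewrite !iotaD !map_cat add0n; congr (_ ++ (_ ++ _)).
  + apply/eq_in_map => p; rewrite mem_iota /= => Hp; rewrite /f.
    have -> : nth true (lside l b) p = nth true (lside l true) p.
      by rewrite !lsideE !nth_left.
    by case: b => //; rewrite lab_left.
  + rewrite -[m in iota m]addn0 iotaDl -map_comp; apply/eq_in_map => p.
    rewrite mem_iota /= => Hp; rewrite /f.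
    by rewrite !lsideE !nth_mid.
  rewrite -[(m + size _)%N]addn0 iotaDl -map_comp; apply/eq_in_map => j.
  rewrite mem_iota /= => Hj; rewrite /f -addnA.
  have -> : nth true (lside l true) (m + (size (pdom g) + j)) =
    nth true (lside l b) (m + (size (pside g b) + j)).
    by rewrite -[pdom g]/(pside g true) !lsideE !nth_right.
  by case: b => //; rewrite -lab_right.
- rewrite -map_comp; apply: (@eq_from_nth _ true) => [|p].
    by rewrite size_map size_iota.
  rewrite size_map size_iota => Hp; rewrite (nth_map 0) ?size_iota // nth_iota
    //=.
  by rewrite nth_left.
rewrite -map_comp; apply: (@eq_from_nth _ true) => [|p].
  by rewrite size_map size_iota.
rewrite size_map size_iota => Hp; rewrite (nth_map 0) ?size_iota // nth_iota
  //=.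
by rewrite nth_right.
Qed.

Lemma lab_mid b i : (i < size (pside g b))%N -> nth true (pside g b) i = b ->
  lab (is_cross g != b) (m + (1 - i)) =
  ((lab b (m + i)).1, (lab b (m + i)).2 + (if (lab b (m + i)).1 then lexp l b
    (m + i) else 0)).
Proof.
move=> Hi Ho; apply: lab_through; rewrite ?through_mid //.
  by rewrite lsideE !size_cat ltn_add2l ltn_addr.
by rewrite lsideE nth_mid.
Qed.

(** If one strand of a crossing is coloured, its passage contributes exactly [lweight]; if both are,
    [lweight] vanishes and the two passages give the last term. At a turn the arms cancel by
    [flow_turn]. *)
Lemma labelled_clayer : let p := (lab true m).1 in let q := (lab true m.+1).1 in
  clayer l (map fst (labelled true)) (map fst (labelled false)) (lweight l p q)
    /\
  gain (labelled false) = gain (labelled true) + lweight l p q +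
    (lsign l *+ (p && q), lsign l *+ (p && q)).
Proof.
move=> p q; have [A [B H]] := labelledE.
have [[-> [EA EB]] [-> _]] := (H true, H false).
rewrite !map_cat !gain_cat /=.
suff [G ->] : cpiece g
   [seq i.1 | i <- [seq (nth true (pdom g) p0, (lab true (m + p0)).1,
     (lab true (m + p0)).2)
      | p0 <- iota 0 (size (pdom g))]]
   [seq i.1 | i <- [seq (nth true (pcod g) p0, (lab false (m + p0)).1,
     (lab false (m + p0)).2)
      | p0 <- iota 0 (size (pcod g))]] (lweight l p q) /\
   gain [seq (nth true (pcod g) p0, (lab false (m + p0)).1,
     (lab false (m + p0)).2)
      | p0 <- iota 0 (size (pcod g))] =
   gain [seq (nth true (pdom g) p0, (lab true (m + p0)).1,
     (lab true (m + p0)).2)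
      | p0 <- iota 0 (size (pdom g))] + (lweight l p q +
    (lsign l *+ (p && q), lsign l *+ (p && q))).
  split; first by constructor => //; rewrite -map_comp.
  by rewrite -!addrA; congr (_ + _); congr (_ + _); rewrite addrA addrC.
rewrite {H A B EA EB}/gain /p /q.
have pairE (x : bool * Lambda) : (x.1, x.2) = x by case: x.
have Hm b i := @lab_mid b i.
case Eg: (g) Hm => [ov a b|a|a] Hm /=;
  rewrite ?big_cons ?big_nil /= ?addn0 ?addn1 ?addr0 ?pairE.
(* The strand of orientation [a] enters on side [a], at offset 0 on the top or 1 on the bottom,
   hence the offset [~~ a]; for the strand of orientation [b] the offset is [b]. *)
- have [|-> ->] := @flow_through a (lab true m) (lab false m.+1)
    (if ov then upow (csign ov a b) else vpow (csign ov a b)).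
    move: (Hm a (~~ a)); case: a Eg Hm => Eg Hm /= /(_ isT erefl);
      by rewrite (lexp_mid _ Eg) // ?addn0 ?addn1 => ->; case: (ov).
  have [|-> ->] := @flow_through b (lab true m.+1) (lab false m)
    (if ov then vpow (csign ov a b) else upow (csign ov a b)).
    move: (Hm b b); case: b Eg Hm => Eg Hm /= /(_ isT erefl);
      by rewrite (lexp_mid _ Eg) // ?addn0 ?addn1 => ->; case: (ov).
  rewrite /lweight /lsign /= Eg; split; first by constructor.
  rewrite addrC addrACA; congr (_ + _).
  by case: (ov) (a) (b) (lab true m).1 (lab true m.+1).1 => [] [] [] [] [].
(* A minimum is entered by its downward arm, at offset [~~ a], and a maximum by its upward arm, at
   offset [a]; turns add no exponent. *)
- have E : lab true m.+1 = lab true m.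
    move: (Hm true (~~ a)); case: a Eg Hm => Eg Hm /= /(_ isT erefl);
    by rewrite /lexp /= Eg if_same addr0 ?addn0 ?addn1 pairE.
  rewrite E flow_turn /lweight /lsign /= Eg /= !add0r; split;
    [exact: CCup|by rewrite !mul0rn].
have E : lab false m.+1 = lab false m.
  move: (Hm false a); case: a Eg Hm => Eg Hm /= /(_ isT erefl);
  by rewrite /lexp /= Eg if_same addr0 ?addn0 ?addn1 pairE.
rewrite E flow_turn /lweight /lsign /= Eg /= !add0r; split;
  [exact: CCap|by rewrite !mul0rn].
Qed.

End Layer.

Lemma sum_iota (V : nmodType) n (F : nat ->
  V) : \sum_(p <- iota 0 n) F p = \sum_(p < n) F p.
Proof. by rewrite -(big_mkord predT) /index_iota subn0. Qed.

(** * The labels along one string and its weight *)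

Section StringRun.
Context (n : nat) (D : seq layer) (i : nat).
Hypothesis st : stack (ends n) D (ends n).
Hypothesis lti : (i < n)%N.

Definition trajectory_exponent (m : nat) : Lambda :=
  \sum_(r < m) oapp (exponent n D) 0 (trajectory n D i r).

(** The time of passage chosen by [xget] is unique by [trajectory_inj]; off the string the exponent
    is set to 0. *)
Definition label (x : nat * nat) : bool * Lambda :=
  (`[< on_string n D i x >],
   if `[< on_string n D i x >] then
     trajectory_exponent (xget 0%N [set m | trajectory n D i m = Some
       x]%classic)
   else 0).

Lemma label_trajectory m x : trajectory n D i m = Some x ->
  label x = (true, trajectory_exponent m).
Proof.
move=> E; rewrite /label; have -> : `[< on_string n D i x >] by apply/asboolP;
  exists m.
congr (_, trajectory_exponent _); case: xgetP => [m' _ /= E'|/(_ m)//].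
by case: (trajectory_inj st lti lti E E').
Qed.

Lemma label_next x y : is_point n D x -> next_point n D x = Some y ->
  label y = ((label x).1, (label x).2 + (if (label x).1 then exponent n D x
    else 0)).
Proof.
move=> Hx Hn; case: (asboolP (on_string n D i x)) => [[m E]|H].
  rewrite (label_trajectory E) /= (@label_trajectory m.+1); last first.
    by rewrite trajectoryS /trajectory E.
  by rewrite /trajectory_exponent big_ord_recr /= /trajectory E.
have H' : ~ on_string n D i y by rewrite (on_string_next st lti Hx Hn).
by rewrite /label !asboolF //= addr0.
Qed.

Definition label_level (k : nat) : seq (strand * Lambda) :=
  [seq ((nth true (level n D k) p, (label (k, p)).1), (label (k, p)).2)
     | p <- iota 0 (size (level n D k))].

Definition on_left k := `[< on_string n D i (k,
  size (lleft (nth layer0 D k))) >].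
Definition on_right k := `[< on_string n D i (k,
  (size (lleft (nth layer0 D k))).+1) >].

Definition self_weight k : Lambda :=
  (crossing_sign D k *+ (on_left k && on_right k),
    crossing_sign D k *+ (on_left k && on_right k)).

Lemma label_level_layer k : (k < size D)%N ->
  let w := lweight (nth layer0 D k) (on_left k) (on_right k) in
  clayer (nth layer0 D k) (map fst (label_level k)) (map fst (label_level
    k.+1)) w /\
  gain (label_level k.+1) = gain (label_level k) + w + self_weight k.
Proof.
move=> kD; rewrite /self_weight /on_left /on_right.
have lev b : label_level (at_side k b) = [seq ((nth true (lside (nth layer0 D
  k) b) p,
    (label (at_side k b, p)).1), (label (at_side k b, p)).2)
     | p <- iota 0 (size (lside (nth layer0 D k) b))].
  by rewrite /label_level (level_side st).
have H b p c q : (p < size (lside (nth layer0 D k) b))%N ->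
  nth true (lside (nth layer0 D k) b) p = b ->
    through (nth layer0 D k) b p = (c, q) ->
  label (at_side k c, q) = ((label (at_side k b, p)).1, (label (at_side k b,
    p)).2 +
     (if (label (at_side k b, p)).1 then lexp (nth layer0 D k) b p else 0)).
  move=> Hp Hb Ht; rewrite -(exponent_side st kD Hb); apply: label_next.
    rewrite /is_point /= (level_side st) // Hp andbT.
    by case: b {Hp Hb Ht} => //=; apply: ltnW.
  by rewrite (next_ingoing st) // Ht.
have [] := (lev true, lev false); rewrite /= => -> ->.
rewrite /crossing_sign; case: (nth layer0 D k) H => L g R H.
exact: (labelled_clayer H).
Qed.

Definition string_weight : Lambda :=
  \sum_(k < size D) lweight (nth layer0 D k) (on_left k) (on_right k).

(** Layers without a crossing have sign 0 and add nothing to either sum. *)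
Lemma self_writheE : (self_writhe n D i, self_writhe n D i) =
  \sum_(k < size D) self_weight k :> Lambda.
Proof.
have -> : self_writhe n D i = \sum_(k < size D) crossing_sign D k *+ (on_left k
  && on_right k).
  rewrite /self_writhe big_mkcond; apply: eq_bigr => k _.
  rewrite /on_left /on_right; case: asboolP => [[s0 /asboolT ->
    /asboolT ->]//|H].
  case: (eqVneq (crossing_sign D k) 0) => [->|s0]; first by rewrite mul0rn.
  by case: asboolP => // Hl; case: asboolP => // Hr; case: H.
exact: (big_morph (fun x : int => (x, x) : Lambda)).
Qed.

Definition finish : seq strand :=
  [seq (true, `[< on_string n D i (size D, p) >]) | p <- iota 0 n].

Lemma nth_ends p : nth true (ends n) p = true.
Proof. by rewrite nth_nseq if_same. Qed.

Lemma label_top p : (p < n)%N -> label (0%N, p) = (p == i, 0).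
Proof.
move=> ltp; case: eqP => [->|ne].
  by rewrite (@label_trajectory 0) // /trajectory_exponent big_ord0.
rewrite /label asboolF // => -[m E].
by case: ne; have [] := @trajectory_inj n D st p i 0 m (0%N, p) ltp lti erefl E.
Qed.

Lemma label_level_top : label_level 0 = [seq ((true, p == i),
  0) | p <- iota 0 n].
Proof.
have -> : label_level 0 = [seq ((nth true (ends n) p, (label (0%N, p)).1),
  (label (0%N, p)).2) | p <- iota 0 n].
  by rewrite /label_level [level n D 0]/(ends n) size_nseq.
apply/eq_in_map => p.
by rewrite mem_iota add0n => /andP[_ ltp]; rewrite label_top // nth_ends.
Qed.

Lemma label_level_bot : label_level (size D) =
  [seq ((true, `[< on_string n D i (size D, p) >]), (label (size D,
    p)).2) | p <- iota 0 n].
Proof.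
rewrite /label_level (level_last st) size_nseq; apply/eq_map => p.
by rewrite nth_ends.
Qed.

Lemma string_run : crun D (start n i) finish string_weight.
Proof.
have := @levels_crun D (fun k => map fst (label_level k)) _
  (fun k kD => (label_level_layer kD).1).
by rewrite label_level_top label_level_bot -!map_comp.
Qed.

(** The gain starts from 0, as the label at the top of the string has exponent 0, and the increments
    of the layers add up. *)
Lemma gain_bot : gain (label_level (size D)) = string_weight + \sum_(k < size
  D) self_weight k.
Proof.
have H h : (h <= size D)%N -> gain (label_level h) =
    \sum_(k < h) lweight (nth layer0 D k) (on_left k) (on_right k) + \sum_(k <
      h) self_weight k.
  elim: h => [|h IH] hD.
    rewrite !big_ord0 addr0 label_level_top /gain big_map big1 // => p _ /=.
    by rewrite /flow /= if_same.
  rewrite !big_ord_recr /= (label_level_layer hD).2 (IH (ltnW hD)).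
  by rewrite -!addrA; congr (_ + _); rewrite addrCA.
exact: H.
Qed.

Lemma degree_start : degree (start n i) = 1.
Proof.
rewrite /degree /start big_map sum_iota.
by rewrite (bigD1 (Ordinal lti)) //= eqxx big1 ?addr0 // => p;
  rewrite -val_eqE => /negPf /= ->.
Qed.

(** The degree is 1 at the top, hence at the bottom, where all orientations are positive; so a
    single bottom point is coloured. *)
Lemma finishE j : (j < n)%N -> on_string n D i (size D, j) ->
  finish = start n j.
Proof.
move=> ltj Hj; apply/eq_in_map => p; rewrite mem_iota /= => ltp; congr pair.
have := crun_degree string_run; rewrite degree_start /degree /finish big_map.
rewrite sum_iota.
rewrite (bigD1 (Ordinal ltj)) //= (asboolT Hj).
case: eqP => [-> _|/eqP ne]; first exact: asboolT.
(* A second coloured point would make the degree at least 2. *)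
rewrite (bigD1 (Ordinal ltp)) //= => E; apply/negbTE/negP => H; move: E;
  rewrite H.
set S := \sum_(_ < _ | _) _ => E.
have S0 : 0 <= S :> int by apply: Num.Theory.sumr_ge0 => q _; case: ifP.
by move: E S0; lia.
Qed.

(** The endpoint is the only coloured point at the bottom and is directed downwards, so the gain
    there is its accumulated exponent. *)
Lemma trajectory_weight j m : (j < n)%N ->
  trajectory n D i m = Some (size D, j) ->
  trajectory_exponent m = string_weight + (self_writhe n D i,
    self_writhe n D i).
Proof.
move=> ltj E; have Hj : on_string n D i (size D, j) by exists m.
rewrite self_writheE -gain_bot label_level_bot.
have /eq_in_map F := finishE ltj Hj.
rewrite /gain big_map sum_iota.
rewrite (bigD1 (Ordinal ltj)) //= big1 ?addr0 => [|p]; last first.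
  rewrite -val_eqE /= => /negPf ne; have := F p.
  by rewrite mem_iota /= (ltn_ord p) ne => /(_ isT) [->].
by have := congr1 snd (label_trajectory E);
  rewrite /flow /= (asboolT Hj) /= => ->.
Qed.

End StringRun.

(** * Evaluation of presented groups and the matrix *)

Definition mono (w : Lambda) : ZLambda := << 1 *g w >>.

Lemma monoD w z : mono (w + z) = mono w * mono z.
Proof. by rewrite zlmulE zlmulUU mulr1. Qed.

Lemma mono0 : mono 0 = 1. Proof. by []. Qed.

Lemma mono_inj : injective mono.
Proof.
move=> w z /(congr1 (mcoeff w)); rewrite mcoeffUU mcoeffU.
by case: eqP => // _ /eqP; rewrite oner_eq0.
Qed.

Section Functional.
Context (E : choiceType) (R : E -> Lambda -> E -> Prop) (f : E -> ZLambda).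
Hypothesis fR : forall e w e', R e w e' -> f e' = f e * mono w.

(** The homomorphism to the additive group of Z[Lambda] extending [f], with Lambda acting by
    multiplication by monomials; [fR] makes it respect the relations. *)
Definition word_value (s : word E) : ZLambda :=
  \sum_(x <- s) (-1) ^+ x.1 * (f x.2.1 * mono x.2.2).

Lemma word_value_cat s t : word_value (s ++ t) = word_value s + word_value t.
Proof. exact: big_cat. Qed.

Lemma word_value_pcong s t : pcong R s t -> word_value s = word_value t.
Proof.
elim=> {s t} // [s t r _ -> _ -> //|s s' t t' _ Es _ Et|b x|e w e' z Re].
- by rewrite !word_value_cat Es Et.
- rewrite /word_value !big_cons big_nil addr0 -mulrDl.
  by case: b; rewrite /= ?expr0 ?expr1 ?addNr ?subrr mul0r.
by rewrite /word_value !big_seq1 /= (fR Re) monoD mulrA.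
Qed.

Definition value (x : presented R) : ZLambda := word_value (repr x).

Lemma value_pcl s : value (pcl R s) = word_value s.
Proof. by apply: word_value_pcong; apply/pclP; rewrite pcl_repr. Qed.

Lemma valueM (x y : presented R) : value (x * y)%g = value x + value y.
Proof. by rewrite -word_value_cat -value_pcl. Qed.

Lemma value_act (x : presented R) w : value (lact x w) = value x * mono w.
Proof.
rewrite -[lact x w]/(pact x w) /pact value_pcl /value /word_value big_map
  mulr_suml.
by apply: eq_bigr => y _ /=; rewrite monoD !mulrA.
Qed.

Lemma value_gen e : value (pgen R e) = f e.
Proof. by rewrite value_pcl /word_value big_seq1 /= expr0 mul1r mono0 mulr1.
  Qed.

Definition abvalue (x : ab (presented R)) : ZLambda := value (repr x).

Lemma value_abcong (x y : presented R) : abcong x y -> value x = value y.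
Proof.
elim=> {x y} // [x y z _ -> //|x x' y y' _ E1 _ E2|x y];
  first by rewrite !valueM E1 E2.
by rewrite !valueM addrC.
Qed.

Lemma abvalue_abcl (x : presented R) : abvalue (abcl x) = value x.
Proof. by apply: value_abcong; apply/abclP; rewrite abcl_repr. Qed.

Lemma abvalueD : {morph abvalue : x y / x + y}.
Proof.
by move=> x y; rewrite -{1}(abcl_repr x) -{1}(abcl_repr y) -abclM abvalue_abcl
  valueM.
Qed.

Lemma abvalueB : {morph abvalue : x y / x - y}.
Proof. by move=> x y; apply: (addIr (abvalue y)); rewrite -abvalueD !subrK. Qed.

Definition abvalue_additive : {additive ab (presented R) -> ZLambda} :=
  HB.pack abvalue (GRing.isZmodMorphism.Build _ _ abvalue abvalueB).

Lemma abvalueZ (c : ZLambda) x : abvalue (c *: x) = c * abvalue x.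
Proof.
rewrite -[LHS]/(abvalue_additive (\sum_(w <- msupp c) abact w x *~ c@_w))
  raddf_sum.
rewrite [c in RHS](monalgE c) mulr_suml; apply: eq_bigr => w _.
rewrite raddfMz /= -(abcl_repr x) abactE !abvalue_abcl value_act.
have -> : << c@_w *g w >> = mono w *~ c@_w :> ZLambda.
  apply/malgP => z; rewrite mcoeffU raddfMz /= mcoeffU.
  by case: (w == z); rewrite ?mulr1n ?mulr0n ?mul0rz ?intz.
by rewrite mulrzAl mulrC.
Qed.

End Functional.

(** * The exponents [wK] and the entries of [TYM] *)

Section Diagram.
Context (n : nat) (D : diagram n).

Let st : stack (ends n) D (ends n) := proj1 (elimT andP (layersP D)).

Lemma diagram_traced x : is_point n D x ->
  exists2 i, (i < n)%N & on_string n D i x.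
Proof. by have /andP[_ /asboolP] := layersP D; apply. Qed.

Lemma on_string_source j : on_string n D (source D j) (size D, val j).
Proof.
rewrite /source; case: xgetP => [i _ //|no].
have [i lti Hi] := diagram_traced (bot_subproof D j).
by case: (no (Ordinal lti)).
Qed.

Lemma pgen_next (x y : Defs.point D) w : Krel x w y ->
  pgen (@Krel n D) y = lact (pgen (@Krel n D) x) w.
Proof.
move=> H; rewrite -[RHS]/(pact _ _) pactE; apply/pclP.
by rewrite /wshift /= addrC; apply: pcong_rel.
Qed.

Lemma pgen_trajectory (i : 'I_n) m (x : Defs.point D) :
  trajectory n D i m = Some (val x) ->
  pgen (@Krel n D) x = lact (pgen (@Krel n D) (top_point D i))
    (trajectory_exponent n D i m).
Proof.
rewrite /trajectory_exponent; elim: m x => [|m IH] x.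
  case=> E; rewrite big_ord0 lact0; congr (pgen _ _); exact/val_inj.
rewrite trajectoryS big_ord_recr; case E: (trajectory n D i m) => [y|//] /= Hn.
have Hy := trajectory_point st (ltn_ord i) E.
pose z : Defs.point D := exist _ y Hy.
by rewrite (@pgen_next z x (exponent n D y)) // lactD -(IH z).
Qed.

(** A functional on [K] that turns exponents along the string into monomials; it separates the
    possible values of [wK]. *)
Definition string_value (i : nat) (x : Defs.point D) : ZLambda :=
  if (label n D i (val x)).1 then mono (label n D i (val x)).2 else 0.

Lemma string_value_rel i : (i < n)%N -> forall x w y, Krel x w y ->
  string_value i y = string_value i x * mono w.
Proof.
move=> lti x w y [Hn ->]; rewrite /string_value (label_next st lti (valP x) Hn).
by case: (label _ _ _ (val x)) => [[] e] /=; rewrite ?mul0r // monoD.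
Qed.

(** Following the string exhibits one valid exponent. Any two agree, since [string_value] sends the
    top generator to 1 and the bottom one to the monomial of the exponent. *)
Lemma wKE j : let i := val (source D j) in
  wK D j = string_weight n D i + (self_writhe n D i, self_writhe n D i).
Proof.
move=> i; have [m E] := on_string_source j.
have lti : (i < n)%N := ltn_ord _.
rewrite -(trajectory_weight st lti (ltn_ord j) E) -/(trajectory n D i m).
have H := @pgen_trajectory (source D j) m (bot_point D j) E.
rewrite /wK; case: xgetP => [w _ /= Hw|/(_ (trajectory_exponent n D i m))//].
have fR := string_value_rel lti.
have top1 : string_value i (top_point D (source D j)) = 1.
  rewrite /string_value (@label_trajectory _ _ _ st lti 0%N) //=.
  by rewrite /trajectory_exponent big_ord0.
have v z : pgen (Krel (D:=D)) (bot_point D j) =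
    lact (pgen (Krel (D:=D)) (top_point D (source D j))) z ->
    string_value i (bot_point D j) = mono z.
  move=> /(congr1 (value (string_value i))).
  by rewrite (value_act fR) !(value_gen fR) top1 mul1r.
by apply: mono_inj; rewrite -(v _ Hw) -(v _ H).
Qed.

Lemma TYM_entry i j : TYM D i j =
  if i == source D j then mono (string_weight n D (source D j)) else 0.
Proof.
pose wt j := wK D j - (upow (self_writhe n D (source D j)) + vpow (self_writhe
  n D (source D j))).
have Ew k : wt k = string_weight n D (source D k).
  rewrite /wt wKE; set s := self_writhe _ _ _.
  by have -> : upow s + vpow s = (s, s) :> Lambda; [congr pair;
    rewrite /= ?addr0 ?add0r|rewrite addrK].
rewrite -Ew.
have HT k : Tbasis D k = mono (wt k) *: Sbasis D (source D k).
  rewrite /mono -[RHS]/(abscale _ _) abscaleU mulr1z /Sbasis abactE; congr abcl.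
  rewrite -[RHS]/(pact _ _) pactE; apply/pclP; rewrite /wshift /= addrC.
  by apply: pcong_rel; constructor.
rewrite /TYM; case: xgetP => [M _ /= HM|no].
  (* The coordinate functional of [a_i], extended to the [x_k] as the relations dictate; applied to
     column [j] of S M = T it isolates [M i j]. *)
  pose f (e : 'I_n + 'I_n) : ZLambda := match e with
    | inl k => (k == i)%:R | inr k => if i == source D k then mono (wt k) else
      0 end.
  have fR e w e' : Ktrel D e w e' -> f e' = f e * mono w.
    by case=> k /=; rewrite eq_sym; case: eqP; rewrite ?mul1r ?mul0r.
  have := congr1 (abvalue f) (HM j); rewrite /Tbasis abvalue_abcl // value_gen
    //= => ->.
  rewrite -[RHS]/(abvalue_additive fR _) raddf_sum (bigD1 i) //= abvalueZ //.
  rewrite /Sbasis abvalue_abcl // value_gen //= eqxx mulr1 big1 ?addr0 // =>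
    k ne.
  by rewrite abvalueZ // abvalue_abcl // value_gen //= (negPf ne) mulr0.
(* The default value of [xget] is excluded by an explicit solution. *)
pose M := \matrix_(k, l) (if k == source D l then mono (wt l) else 0).
case: (no M) => k; rewrite HT (bigD1 (source D k)) //= mxE eqxx big1 ?addr0 //
  => l ne.
by rewrite mxE (negPf ne) scale0r.
Qed.

End Diagram.

(** * Invariance, multiplicativity and invertibility *)

Section Main.
Context (n : nat).
Implicit Types D : diagram n.

Let st D : stack (ends n) D (ends n) := proj1 (elimT andP (layersP D)).

Lemma source_run D j :
  crun D (start n (source D j)) (start n j) (string_weight n D (source D j)).
Proof.
have := string_run (st D) (ltn_ord (source D j)).
by rewrite (finishE (st D) (ltn_ord _) (ltn_ord j) (on_string_source D j)).
Qed.

Lemma start_inj i i' : (i < n)%N -> start n i = start n i' -> i = i'.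
Proof.
move=> lti /eq_in_map/(_ i); rewrite mem_iota /= lti => /(_ isT) [].
by rewrite eqxx => /esym/eqP.
Qed.

(** Two ends of one string would give two runs with the same initial colours, contrary to
    [crun_det]. *)
Lemma source_inj D : injective (source D).
Proof.
move=> j j' E; apply/val_inj; have := source_run D j; rewrite E => H.
have [+ _] := crun_det (st D) (@diagram_traced _ D) H (source_run D j').
exact: start_inj.
Qed.

(** By uniqueness of runs, any coloured run joining [start n i] to [start n j] reveals both the end
    of the string and the matrix entry. *)
Lemma TYM_run D (i j : 'I_n) w : crun D (start n i) (start n j) w ->
  source D j = i /\ forall k, TYM D k j = if k == i then mono w else 0.
Proof.
move=> H; have [E _] := crun_det (st D) (@diagram_traced _ D) H (string_run (st
  D) (ltn_ord i)).
have Es : source D j = i.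
  apply/val_inj; apply: (on_string_unique (st D) (ltn_ord _) (ltn_ord i)
    (on_string_source D j)).
  move/eq_in_map/(_ (val j)): E; rewrite mem_iota /= (ltn_ord j) => /(_ isT) [].
  by rewrite eqxx => /esym/asboolP.
split=> // k; rewrite TYM_entry Es; congr (if _ then mono _ else _).
by have := source_run D j; rewrite Es =>
  /(crun_det (st D) (@diagram_traced _ D) H) [].
Qed.

Lemma TYM_move D D' : diagram_move D D' -> TYM D = TYM D'.
Proof.
case=> S [T [A [B [mv ED ED']]]]; apply/matrixP => k j.
have H := source_run D j; have [_ ->] := TYM_run H.
(* The run of [D] is split around [A], and its middle part is replaced by a run through [B] with the
   same ends and weight. *)
suff /TYM_run[_ ->] : crun D' (start n (source D j)) (start n j) (string_weight
  n D (source D j)) by [].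
move: H; rewrite ED ED' => /crun_catP[s1 [w1 [w23 [H1 /crun_catP[s2 [w2 [w3 [H2
  H3 ->]]]] ->]]]].
apply/crun_catP; exists s1, w1, (w2 + w3); split=> //.
apply/crun_catP; exists s2, w2, w3; split=> //.
by case: mv => [/planar_move_crun|/reidemeister_move_crun]; apply.
Qed.

Lemma TYM_equivalent D D' : equivalent D D' -> TYM D = TYM D'.
Proof. by elim=> {D D'} [D D' /TYM_move|D|D D' _ ->|D D' D'' _ -> _ ->]. Qed.

Lemma TYM_cat D D' : TYM (dcat D D') = TYM D *m TYM D'.
Proof.
apply/matrixP => k j; rewrite mxE.
pose j' := source D' j; pose i := source D j'.
have [_ HD] := TYM_run (source_run D j');
  have [_ HD'] := TYM_run (source_run D' j).
(* Following the string backwards from [j] through [D'] and then [D] gives two runs that meet at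
   [j']; their weights add. *)
have [|_ ->] := @TYM_run (dcat D D') i j (string_weight n D i + string_weight n
  D' j').
  by apply/crun_catP; exists (start n j'), (string_weight n D i),
    (string_weight n D' j');
    split=> //; apply: source_run.
rewrite (bigD1 j') //= big1 ?addr0 => [|l ne];
  last by rewrite HD' (negPf ne) mulr0.
by rewrite HD HD' eqxx; case: ifP; rewrite ?mul0r // monoD.
Qed.

Lemma TYM_did : TYM (did n) = 1%:M.
Proof.
apply/matrixP => k j; have [|_ ->] := @TYM_run (did n) j j 0;
  first exact: crun_nil.
by rewrite mxE mono0; case: eqP.
Qed.

(** A generalized permutation matrix with monomial entries is inverted by transposing it and
    inverting the monomials; [source_inj] makes the off-diagonal entries of the product vanish. *)
Lemma TYM_unit D : TYM D \in unitmx.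
Proof.
pose N : 'M[ZLambda]_n := \matrix_(j, i)
  if i == source D j then mono (- string_weight n D (source D j)) else 0.
suff /mulmx1_unit[] : N *m TYM D = 1%:M by [].
apply/matrixP => j j'; rewrite !mxE (bigD1 (source D j)) //= big1 ?addr0 =>
  [|i ne].
  rewrite mxE eqxx TYM_entry (inj_eq (@source_inj D)); case: eqP => [->|_];
    last by rewrite mulr0.
  by rewrite -monoD addNr.
by rewrite mxE (negPf ne) mul0r.
Qed.

End Main.

Theorem theorem3p7 (n : nat) (n_ge1 : (1 <= n)%N) :
  [/\ forall L L' : diagram n, equivalent L L' -> TYM L = TYM L',
      forall L L' : diagram n, TYM (dcat L L') = TYM L *m TYM L'
    & exists rho : SL n -> GL n,
        [/\ forall L : diagram n, GLmx (rho (slclass L)) = TYM L,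
            rho 1%g = 1%g
          & forall x y : SL n, rho (x * y)%g = (rho x * rho y)%g]].
Proof.
split; [exact: TYM_equivalent|exact: TYM_cat|].
(* The value on a class is computed from its chosen representative; invariance makes it agree with
   [TYM] on every diagram of the class. *)
pose rho (x : SL n) : GL n := exist _ (TYM (repr x)) (TYM_unit (repr x)).
have rhoE L : GLmx (rho (slclass L)) = TYM L.
  by apply: TYM_equivalent; apply/slclassP; rewrite slclass_repr.
exists rho; split=> // [|x y]; apply: val_inj.
  by rewrite [LHS]rhoE TYM_did.
rewrite -(slclass_repr x) -(slclass_repr y) -[(_ * _)%g]/(slmul _ _) slmulE.
by rewrite [LHS]rhoE TYM_cat -!rhoE.
Qed.
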